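(* (1) In every regular weighted limit game, Player $0$ has an optimal finite-state strategy. (2) The problem ''Given an arena $\mathcal{A}$ and a DFA $\mathfrak{A}$ (over the colors of $\mathcal{A}$, with $\epsilon\notin L(\mathfrak{A})$), compute an optimal strategy for Player $0$ in the weighted limit game $(\mathcal{A},\lim(L(\mathfrak{A})))$'' is solvable in time $\mathcal{O}(|V|^3\cdot|E|\cdot|Q|^2\cdot|F|^2)$ in the unit-cost model for arithmetic operations, where $(V,E)$ is the graph underlying $\mathcal{A}$, and $Q$ and $F$ are the sets of states and of accepting states of $\mathfrak{A}$.
   Context: $\mathbb{N}$ denotes the nonnegative integers, $\overline{\mathbb{N}}=\mathbb{N}\cup\{\infty\}$ with $n<\infty$ and $n+\infty=\infty$; $\min\emptyset=\infty$. Fix a finite nonempty set $C$ of colors. A DFA $\mathfrak{A}=(Q,C,q_I,\delta,F)$ has finite state set $Q$, initial state $q_I$, transition function $\delta\colon Q\times C\to Q$ and accepting states $F\subseteq Q$; $L(\mathfrak{A})\subseteq C^*$ is its language. An arena $\mathcal{A}=(V,V_0,V_1,E,w,c)$ consists of a finite directed graph $(V,E)$ in which every vertex has an outgoing edge, a partition of $V$ into vertices $V_0$ of Player $0$ and $V_1$ of Player $1$, a weight function $w\colon E\to\mathbb{N}$ and a coloring $c\colon V\to C$. A play is an infinite path $\rho=v_0v_1v_2\cdots$. The weight of a finite path is the sum of the weights of its edges; $c$ is applied vertex-wise to paths. For $K\subseteq C^*$ with $\epsilon\notin K$, $\lim(K)$ is the set of $\alpha_0\alpha_1\cdots\in C^\omega$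 with $\alpha_0\cdots\alpha_j\in K$ for infinitely many $j$. A weighted limit game is $\mathcal{G}=(\mathcal{A},\lim(K))$; it is regular if $K=L(\mathfrak{A})$ for a DFA $\mathfrak{A}$ over $C$. The value of a play (depending on $K$) is $$\mathrm{val}_{\mathcal{G}}(v_0v_1v_2\cdots)=\sup_{j\in\mathbb{N}}\ \min_{j'>j,\ c(v_0\cdots v_{j'})\in K} w(v_j\cdots v_{j'})\in\overline{\mathbb{N}}.$$ A strategy for Player $i$ is a map $\sigma\colon V^*V_i\to V$ with $(v_j,\sigma(v_0\cdots v_j))\in E$; a play is consistent with $\sigma$ if $v_{j+1}=\sigma(v_0\cdots v_j)$ whenever $v_j\in V_i$. For a strategy $\sigma$ of Player $0$, $\mathrm{val}_{\mathcal{G}}(\sigma,v)=\sup_\rho\mathrm{val}_{\mathcal{G}}(\rho)$ over all plays $\rho$ starting in $v$ and consistent with $\sigma$. A strategy $\sigma$ for Player $0$ is optimal if $\mathrm{val}_{\mathcal{G}}(\sigma,v)\le\mathrm{val}_{\mathcal{G}}(\sigma',v)$ for every strategy $\sigma'$ for Player $0$ and every vertex $v$. A memory structure $(M,\mathrm{init},\mathrm{upd})$ has a finite set $M$, $\mathrm{init}\colon V\to M$ and $\mathrm{upd}\colon M\times V\to M$; $\mathrm{upd}^*(v)=\mathrm{init}(v)$ and $\mathrm{upd}^*(\pi v)=\mathrm{upd}(\mathrm{upd}^*(\pi),v)$ for nonempty $\pi\in V^*$. A strategy $\sigma$ for Player $i$ is finite-state if for some memory structure and some $\mathrm{Nxt}\colon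 V_i\times M\to V$ with $(v,\mathrm{Nxt}(v,m))\in E$ one has $\sigma(v_0\cdots v_j)=\mathrm{Nxt}(v_j,\mathrm{upd}^*(v_0\cdots v_j))$. *)

(* Defs.v *)
From mathcomp Require Import all_boot.
From mathcomp Require Import boolp classical_sets.

Set Implicit Arguments.
Unset Strict Implicit.
Unset Printing Implicit Defensive.

Local Open Scope classical_set_scope.

(* Extended naturals: [None] is infinity. *)
Definition enat := option nat.

Definition lee (x y : enat) : bool :=
  if y is Some n then (if x is Some m then m <= n else false) else true.

(* The minimum of the empty set is infinity. *)
Definition emin (A : set nat) : enat :=
  if pselect (exists n, `[< A n >]) is left nonempty
  then Some (ex_minn nonempty) else None.

(* The least upper bound in the extended naturals: the least natural upper
   bound if there is one, and infinity otherwise. *)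
Definition esup (A : set enat) : enat :=
  emin [set n | forall x, A x -> lee x (Some n)].

Record dfa (C : finType) := Dfa {
  state : finType;
  initial : state;
  step : state -> C -> state;
  accepting : {set state}
}.

Definition language (C : finType) (D : dfa C) : set (seq C) :=
  [set x | foldl (@step C D) (initial D) x \in accepting D].

(* Vertices outside [owned0] belong to Player 1.  [weight] is total, but only
   its values on [edges] are ever used. *)
Record arena (C : finType) := Arena {
  vertex :> finType;
  owned0 : {set vertex};
  edges : {set vertex * vertex};
  weight : vertex * vertex -> nat;
  color : vertex -> C;
  edges_total : forall v, exists u, (v, u) \in edges
}.

(* The weighted limit game with winning condition lim(goal). Values are defined
   from [goal] itself, not from its limit. *)
Record game (C : finType) := Game {
  game_arena : arena C;
  goal : set (seq C);
  goal_nonempty_words : ~ goal [::]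
}.

Definition regular (C : finType) (G : game C) : Prop :=
  exists D : dfa C, goal G = language D.

Section Arena.
Context (C : finType) (A : arena C).

Definition play := nat -> A.

Definition is_play (rho : play) : Prop :=
  forall j, (rho j, rho j.+1) \in edges A.

Definition infix_weight (rho : play) (j j' : nat) : nat :=
  \sum_(j <= i < j') weight (rho i, rho i.+1).

Definition play_value (K : set (seq C)) (rho : play) : enat :=
  esup [set emin [set infix_weight rho j j' | j' in
                    [set j' | j < j' /\
                              K [seq color (rho i) | i <- iota 0 j'.+1]]]
       | j in [set: nat]].

(* A nonempty vertex sequence is given by its head [x] and its tail [s], so that
   its final vertex is [last x s]. *)
Record strategy := Strategy {
  move :> A -> seq A -> A;
  move_edge : forall x s, last x s \in owned0 A ->
                (last x s, move x s) \in edges A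
}.

Definition consistent (sigma : strategy) (rho : play) : Prop :=
  forall j, rho j \in owned0 A ->
    rho j.+1 = sigma (rho 0) [seq rho i | i <- iota 1 j].

Definition strategy_value (K : set (seq C)) (sigma : strategy) (v : A) : enat :=
  esup [set play_value K rho | rho in
          [set rho | [/\ is_play rho, rho 0 = v & consistent sigma rho]]].

Record memory := Memory {
  mem_state : finType;
  mem_init : A -> mem_state;
  mem_upd : mem_state -> A -> mem_state
}.

Definition upd_star (M : memory) (x : A) (s : seq A) : mem_state M :=
  foldl (@mem_upd M) (mem_init M x) s.

Definition implemented_by (M : memory) (nxt : A -> mem_state M -> A)
    (sigma : strategy) : Prop :=
  (forall v m, v \in owned0 A -> (v, nxt v m) \in edges A) /\
  (forall x s, last x s \in owned0 A ->
     sigma x s = nxt (last x s) (upd_star M x s)).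

Definition finite_state (sigma : strategy) : Prop :=
  exists (M : memory) (nxt : A -> mem_state M -> A), implemented_by nxt sigma.

End Arena.

Definition optimal (C : finType) (G : game C)
    (sigma : strategy (game_arena G)) : Prop :=
  forall (sigma' : strategy (game_arena G)) (v : game_arena G),
    lee (strategy_value (goal G) sigma v) (strategy_value (goal G) sigma' v).

(* Random-access machine, presented as structured programs.  The memory consists
   of arrays, named by naturals and indexed by naturals, whose cells hold
   unbounded naturals.  A program mentions only finitely many array names, since
   these are literals, whereas indices are computed.  Addition, truncated
   subtraction and comparison (with result 0 or 1) are the only operations on
   numbers, each at unit cost; multiplication is deliberately not one of them. *)
Definition store := nat -> nat -> nat.

Inductive expr :=
  | Lit of nat
  | Cell of nat & expr
  | Add of expr & expr
  | Sub of expr & expr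
  | Lt of expr & expr
  | Eq of expr & expr.

Inductive prog :=
  | Skip
  | Assign of nat & expr & expr
  | Seq of prog & prog
  | If of expr & prog & prog
  | While of expr & prog.

Fixpoint eval (s : store) (e : expr) : nat :=
  match e with
  | Lit n => n
  | Cell a e1 => s a (eval s e1)
  | Add e1 e2 => eval s e1 + eval s e2
  | Sub e1 e2 => eval s e1 - eval s e2
  | Lt e1 e2 => eval s e1 < eval s e2
  | Eq e1 e2 => eval s e1 == eval s e2
  end.

Fixpoint cost (e : expr) : nat :=
  match e with
  | Lit _ => 1
  | Cell _ e1 => (cost e1).+1
  | Add e1 e2 | Sub e1 e2 | Lt e1 e2 | Eq e1 e2 => (cost e1 + cost e2).+1
  end.

Definition set_cell (s : store) (a i n : nat) : store :=
  fun b j => if (b == a) && (j == i) then n else s b j.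

(* [exec p s t s']: started in [s], [p] halts in [s'] after [t] unit-cost
   operations.  [Assign a e1 e2] stores the value of [e2] in cell [e1] of array
   [a]; a guard holds when its value is nonzero. *)
Inductive exec : prog -> store -> nat -> store -> Prop :=
  | ExecSkip s : exec Skip s 1 s
  | ExecAssign a e1 e2 s :
      exec (Assign a e1 e2) s (cost e1 + cost e2).+1
        (set_cell s a (eval s e1) (eval s e2))
  | ExecSeq p q s t s' u s'' :
      exec p s t s' -> exec q s' u s'' -> exec (Seq p q) s (t + u) s''
  | ExecIfTrue e p q s t s' :
      eval s e != 0 -> exec p s t s' -> exec (If e p q) s (cost e + t).+1 s'
  | ExecIfFalse e p q s t s' :
      eval s e = 0 -> exec q s t s' -> exec (If e p q) s (cost e + t).+1 s'
  | ExecWhileTrue e p s t s' u s'' :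
      eval s e != 0 -> exec p s t s' -> exec (While e p) s' u s'' ->
      exec (While e p) s (cost e + t + u).+1 s''
  | ExecWhileFalse e p s :
      eval s e = 0 -> exec (While e p) s (cost e).+1 s.

(* [exec_within p s b s'] means that [p], started in [s], halts in [s'] after at
   most [b] operations. *)
Definition exec_within (p : prog) (s : store) (b : nat) (s' : store) : Prop :=
  exists2 t, exec p s t s' & t <= b.

(* Elements of finite types are represented by their position in [enum]. *)
Definition code (T : finType) (x : T) : nat := enum_rank x.

(* Input arrays 0 to 7: sizes and initial state; owner; color; source, target
   and weight of the i-th edge; transition table (by rows); accepting flags. The
   other arrays are initially zero; nothing is assumed about cells of input
   arrays outside the range of the data. *)
Definition encodes_input (C : finType) (A : arena C) (D : dfa C) (s : store) :
    Prop :=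
  [/\ [/\ s 0 0 = #|A|, s 0 1 = #|edges A|, s 0 2 = #|state D|,
          s 0 3 = #|C| & s 0 4 = code (initial D)],
      forall v : A, s 1 (code v) = (v \in owned0 A) /\
                    s 2 (code v) = code (color v),
      forall i : 'I_#|edges A|,
        [/\ s 3 i = code (enum_val i).1, s 4 i = code (enum_val i).2
          & s 5 i = weight (enum_val i)],
      forall q : state D,
        (forall x : C, s 6 (code q * #|C| + code x) = code (step q x)) /\
        s 7 (code q) = (q \in accepting D)
    & forall a i, 8 <= a -> s a i = 0].

(* Output arrays 8 to 11: the number of memory states, and the tables of the
   initialization, update (by memory states) and next-move (by memory states)
   functions of a finite-state implementation of [sigma]. *)
Definition encodes_strategy (C : finType) (A : arena C) (sigma : strategy A)
    (s : store) : Prop :=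
  exists (M : memory A) (nxt : A -> mem_state M -> A),
    [/\ implemented_by nxt sigma,
        s 8 0 = #|mem_state M|,
        forall v : A, s 9 (code v) = code (mem_init M v),
        forall (m : mem_state M) (v : A),
          s 10 (code m * #|A| + code v) = code (mem_upd m v)
      & forall (m : mem_state M) (v : A), v \in owned0 A ->
          s 11 (code m * #|A| + code v) = code (nxt v m)].

(* Main.v *)
(* Work in the product of the arena with the DFA, whose accepting positions form
   a set F. For X included in F let d_X(p) be the least weight within which
   Player 0 can force a visit to X, in at least one step, from p; a Dijkstra-like
   procedure computes it together with a positional strategy. Starting from
   X_0 = F, let N_k be the maximum of d_{X_k} on X_k, and obtain X_{k+1} from X_k
   by deleting a position at which this maximum is attained. Playing the strategy
   for X_k forever answers every request within max (d_{X_k}(p), N_k), where p is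
   the initial position; the optimal strategy picks a phase k minimizing this
   number and stays in it, so its memory is k and the DFA state. Conversely,
   suppose that some strategy has value n at p, and let R be the set of accepting
   positions that occur in its plays. As long as R is included in X_k, we have
   d_{X_k} <= n at p and on R, since Player 1 could otherwise delay the next visit
   to X_k, hence to R, beyond n. If N_k > n, the deleted position is thus not in R
   and R is included in X_{k+1}; since the sets become empty, this stops at some k
   with N_k <= n, and then max (d_{X_k}(p), N_k) <= n. There are
   |F| + 1 phases, each with as many rounds as positions, and a round scans all
   edges once for each position. *)
Require Import Defs.
From mathcomp Require Import all_boot.
From mathcomp Require Import zify.
From mathcomp Require Import boolp classical_sets.

Set Implicit Arguments.
Unset Strict Implicit.
Unset Printing Implicit Defensive.

(** * Programs with bounded loops *)

(** The number of iterations of a [For] is read from memory on entry, so loops terminate, [run] is a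
    total function and a time bound can be read off the syntax. *)
Inductive loop :=
  | Nop
  | Put of nat & expr & expr
  | Then of loop & loop
  | Cond of expr & loop & loop
  | For of nat & nat & nat & loop.

Notation scalar a := (Cell a (Lit 0)).
Infix ";;" := Then (at level 61, right associativity).

Fixpoint compile (l : loop) : prog :=
  match l with
  | Nop => Skip
  | Put a e1 e2 => Assign a e1 e2
  | Then l1 l2 => Seq (compile l1) (compile l2)
  | Cond e l1 l2 => If e (compile l1) (compile l2)
  | For i a j l1 =>
      Seq (Assign i (Lit 0) (Lit 0))
        (While (Lt (scalar i) (Cell a (Lit j)))
           (Seq (compile l1) (Assign i (Lit 0) (Add (scalar i) (Lit 1)))))
  end.

Fixpoint run (l : loop) (s : store) : store :=
  match l with
  | Nop => s
  | Put a e1 e2 => set_cell s a (eval s e1) (eval s e2)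
  | Then l1 l2 => run l2 (run l1 s)
  | Cond e l1 l2 => if eval s e != 0 then run l1 s else run l2 s
  | For i a j l1 =>
      iteri (s a j) (fun k t => set_cell (run l1 t) i 0 k.+1) (set_cell s i 0 0)
  end.

Fixpoint writes (l : loop) : seq nat :=
  match l with
  | Nop => [::]
  | Put a _ _ => [:: a]
  | Then l1 l2 | Cond _ l1 l2 => writes l1 ++ writes l2
  | For i _ _ l1 => i :: writes l1
  end.

Fixpoint bounds (l : loop) : seq nat :=
  match l with
  | Nop | Put _ _ _ => [::]
  | Then l1 l2 | Cond _ l1 l2 => bounds l1 ++ bounds l2
  | For _ a _ l1 => a :: bounds l1
  end.

Fixpoint counters_free (l : loop) : bool :=
  match l with
  | Nop | Put _ _ _ => true
  | Then l1 l2 | Cond _ l1 l2 => counters_free l1 && counters_free l2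
  | For i _ _ l1 => (i \notin writes l1) && counters_free l1
  end.

Definition bounds_fixed (l : loop) := all [pred a | a \notin writes l] (bounds l).

(** The part of the running time that depends on the program text alone; [rounds] is the part that
    depends on the input. An iteration of [For] pays 6 for the guard and 6 for the increment, hence
    12. *)
Fixpoint overhead (l : loop) : nat :=
  match l with
  | Nop => 1
  | Put _ e1 e2 => (cost e1 + cost e2).+1
  | Then l1 l2 => overhead l1 + overhead l2
  | Cond e l1 l2 => (cost e + (overhead l1 + overhead l2)).+1
  | For _ _ _ l1 => overhead l1 + 12
  end.

(** A maximum suffices for consecutive parts because [overhead] adds them up. The extra round of a
    [For] pays for the initialization of the counter and the final test. *)
Fixpoint rounds (s : store) (l : loop) : nat :=
  match l with
  | Nop | Put _ _ _ => 1
  | Then l1 l2 | Cond _ l1 l2 => maxn (rounds s l1) (rounds s l2)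
  | For _ a j l1 => (s a j).+1 * rounds s l1
  end.

Lemma set_cell_neq s a i n b : b != a -> set_cell s a i n b = s b.
Proof. by move=> /negPf ba; apply/funext => j; rewrite /set_cell ba. Qed.

Lemma run_frame l s a : a \notin writes l -> run l s a = s a.
Proof.
elim: l s => //= [b e1 e2|l1 IH1 l2 IH2|e l1 IH1 l2 IH2|i b j l1 IH] s.
- by rewrite inE => ab; rewrite set_cell_neq.
- by rewrite mem_cat negb_or => /andP[a1 a2]; rewrite IH2 ?IH1.
- by rewrite mem_cat negb_or => /andP[a1 a2]; case: ifP => _; rewrite ?IH2 ?IH1.
rewrite inE negb_or => /andP[ai al1].
by elim: (s b j) => [|k IHk] /=; rewrite set_cell_neq // IH.
Qed.

(** The frame condition comes for free in the induction step, so an invariant need only mention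
    arrays that the body writes. *)
Lemma run_for (I : nat -> store -> Prop) i a j l s :
  I 0 (set_cell s i 0 0) ->
  (forall k t, k < s a j -> t i 0 = k ->
     (forall b, b \notin i :: writes l -> t b = s b) ->
     I k t -> I k.+1 (set_cell (run l t) i 0 k.+1)) ->
  I (s a j) (run (For i a j l) s).
Proof.
move=> I0 IS /=.
set f := fun _ _ => _.
suff: forall k, k <= s a j ->
   [/\ I k (iteri k f (set_cell s i 0 0)), iteri k f (set_cell s i 0 0) i 0 = k
     & forall b, b \notin i :: writes l -> iteri k f (set_cell s i 0 0) b = s b].
  by move=> /(_ (s a j) (leqnn _)) [].
elim=> [_|k IHk kN] /=.
  split=> // [|b]; first by rewrite /set_cell !eqxx.
  by rewrite inE negb_or => /andP[bi _]; rewrite set_cell_neq.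
have [Ik ki kb] := IHk (ltnW kN); split.
- exact: IS.
- by rewrite /f /set_cell !eqxx.
- move=> b bl; rewrite /f set_cell_neq ?run_frame ?kb //.
    by move: bl; rewrite inE negb_or => /andP[].
  by move: bl; rewrite inE negb_or => /andP[].
Qed.

Lemma rounds_gt0 s l : 0 < rounds s l.
Proof.
by elim: l => //= [l1 IH1 l2 IH2|_ l1 IH1 l2 IH2|*]; rewrite ?leq_max ?IH1 //
  muln_gt0.
Qed.

Lemma eq_rounds s t l :
  (forall a, a \in bounds l -> s a = t a) -> rounds s l = rounds t l.
Proof.
elim: l => //= [l1 IH1 l2 IH2|_ l1 IH1 l2 IH2|i a j l IH] st.
- by rewrite IH1 ?IH2 // => a al; apply: st; rewrite mem_cat al ?orbT.
- by rewrite IH1 ?IH2 // => a al; apply: st; rewrite mem_cat al ?orbT.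
- by rewrite IH ?st ?mem_head // => b bl; apply: st; rewrite inE bl orbT.
Qed.

Lemma sub_bounds_fixed (l1 l : loop) : bounds_fixed l ->
  {subset bounds l1 <= bounds l} -> {subset writes l1 <= writes l} ->
  bounds_fixed l1.
Proof.
move=> /allP fl bl wl; apply/allP => a /bl /fl /=; apply: contra; exact: wl.
Qed.

(** Arrays that hold bounds are never written, so [rounds] has the same value in all intermediate
    stores; bodies do not touch their counters, so the compiled increment agrees with the counter
    set by [run]. *)
Lemma exec_compile l s : counters_free l -> bounds_fixed l ->
  exec_within (compile l) s (overhead l * rounds s l) (run l s).
Proof.
elim: l s => [|a e1 e2|l1 IH1 l2 IH2|e l1 IH1 l2 IH2|i a j l IH] s.
- by move=> _ _; exists 1 => //; constructor.
- by move=> _ _; exists (cost e1 + cost e2).+1; [constructor|rewrite muln1].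
- move=> /andP[c1 c2] fl.
  have f1 : bounds_fixed l1.
    by apply: (sub_bounds_fixed fl) => a al; rewrite /= mem_cat al.
  have f2 : bounds_fixed l2.
    by apply: (sub_bounds_fixed fl) => a al; rewrite /= mem_cat al orbT.
  have [t1 E1 b1] := IH1 s c1 f1; have [t2 E2 b2] := IH2 (run l1 s) c2 f2.
  exists (t1 + t2); first exact: ExecSeq E1 E2.
  have e2 : rounds (run l1 s) l2 = rounds s l2.
    apply: eq_rounds => a al; rewrite run_frame //.
    move/allP: fl => /(_ a); rewrite /= !mem_cat al orbT negb_or => /(_ isT).
    by case/andP.
  rewrite e2 in b2; rewrite mulnDl leq_add //=.
    by rewrite (leq_trans b1) // leq_mul2l leq_maxl orbT.
  by rewrite (leq_trans b2) // leq_mul2l leq_maxr orbT.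
- move=> /andP[c1 c2] fl.
  have f1 : bounds_fixed l1.
    by apply: (sub_bounds_fixed fl) => a al; rewrite /= mem_cat al.
  have f2 : bounds_fixed l2.
    by apply: (sub_bounds_fixed fl) => a al; rewrite /= mem_cat al orbT.
  have [t1 E1 b1] := IH1 s c1 f1; have [t2 E2 b2] := IH2 s c2 f2.
  have m0 : 0 < maxn (rounds s l1) (rounds s l2) by rewrite leq_max rounds_gt0.
  rewrite /=; case: eqP => [e0|/eqP e0] /=.
    exists (cost e + t2).+1; first exact: ExecIfFalse.
    have : t2 <= overhead l2 * maxn (rounds s l1) (rounds s l2).
      by rewrite (leq_trans b2) // leq_mul2l leq_maxr orbT.
    by nia.
  exists (cost e + t1).+1; first exact: ExecIfTrue.
  have : t1 <= overhead l1 * maxn (rounds s l1) (rounds s l2).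
    by rewrite (leq_trans b1) // leq_mul2l leq_maxl orbT.
  by nia.
rewrite /= => /andP[il cl] fl.
have fl1 : bounds_fixed l.
  by apply: (sub_bounds_fixed fl) => b bl; rewrite /= inE bl orbT.
have nw b : b \in a :: bounds l -> b \notin i :: writes l.
  by move/allP: fl; apply.
have := nw a; rewrite mem_head inE negb_or => /(_ isT) /andP[ai al].
set f := fun _ _ => _; set s0 := set_cell s i 0 0.
pose st k := iteri k f s0.
have sti k : st k i 0 = k by case: k => [|k]; rewrite /st /= ?/f ?/s0 /set_cell
  !eqxx.
have stw k b : b \notin i :: writes l -> st k b = s b.
  move=> bw; have := bw; rewrite inE negb_or => /andP[bi bl].
  elim: k => [|k IHk]; rewrite /st /= ?/s0 ?/f; first by rewrite set_cell_neq.
  by rewrite set_cell_neq // run_frame.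
have sta k : st k a j = s a j by rewrite stw // nw ?mem_head.
pose body := Seq (compile l) (Assign i (Lit 0) (Add (scalar i) (Lit 1))).
pose c := overhead l * rounds s l.
have bodyE k : exec_within body (st k) (c + 6) (st k.+1).
  have [t E b] := IH (st k) cl fl1.
  have eqr : rounds (st k) l = rounds s l.
    by apply: eq_rounds => b' bl; rewrite stw // nw // inE bl orbT.
  exists (t + 6); last by rewrite leq_add2r /c -eqr.
  apply: (ExecSeq E).
  have EA := ExecAssign i (Lit 0) (Add (scalar i) (Lit 1)) (run l (st k)).
  have sE : run l (st k) i 0 = k by rewrite run_frame ?sti.
  by move: EA; rewrite /= sE (addn1 k).
(* Induction on the number [k] of remaining iterations; the last failing test costs 6. *)
have loopE k : k <= s a j ->
  exec_within (While (Lt (scalar i) (Cell a (Lit j))) body) (st (s a j - k))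
    (k * (c + 12) + 6) (st (s a j)).
  elim: k => [_|k IHk kN].
    rewrite subn0; exists 6 => //.
    have := @ExecWhileFalse (Lt (scalar i) (Cell a (Lit j))) body (st (s a j)).
    by apply; rewrite /= sti sta ltnn.
  have [t E b] := bodyE (s a j - k.+1); have [u E' b'] := IHk (ltnW kN).
  rewrite -(subnSK kN) in E'.
  exists (5 + t + u).+1; last by lia.
  by apply: ExecWhileTrue E E'; rewrite /= sti sta; lia.
have [t E b] := loopE _ (leqnn _); rewrite subnn in E.
exists (3 + t).
  by apply: ExecSeq E; apply: ExecAssign.
have := rounds_gt0 s l; rewrite /c in b; nia.
Qed.

(** * Shortest forced distances *)

(* Distances are coded by naturals: [0] is infinity and [d.+1] is [d]. *)
Definition lec (x y : nat) : bool := (y == 0) || (0 < x <= y).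

Lemma lec_refl x : lec x x. Proof. rewrite /lec; lia. Qed.

Lemma lec_trans y x z : lec x y -> lec y z -> lec x z.
Proof. rewrite /lec; lia. Qed.

(* The product of an arena and a DFA, with vertices below [nv]. The product
   edge [e] at [p] leads to [tau p e]; its target in the arena is [tgt e]. *)
Record ngame := NGame {
  nv : nat;
  own : nat -> bool;
  inc : nat -> nat -> bool;
  tau : nat -> nat -> nat;
  wt : nat -> nat;
  tgt : nat -> nat
}.

Definition wf_ngame (g : ngame) : Prop :=
  (forall p e, p < nv g -> inc g p e -> tau g p e < nv g) /\
  (forall p, p < nv g -> exists e, inc g p e).

Section Bellman.
Context (g : ngame).
Implicit Types (X D rank : nat -> nat) (ok : nat -> Prop).

(** A target is at distance 0, coded 1. Only successors are looked up in this way, so the [D]-value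
    of a target itself measures its next visit, after at least one step. *)
Definition level X D x := if X x != 0 then 1 else D x.

Definition via X D p e :=
  if level X D (tau g p e) != 0 then wt g e + level X D (tau g p e) else 0.

(** The local equation at [p]: a minimum over edges for Player 0, a maximum for Player 1. [ok]
    constrains the successors on which a finite value relies: the chosen one for Player 0, all of
    them for Player 1. *)
Definition bellman X D ok p c ch : Prop :=
  if own g p then
    (c != 0 -> exists2 e, inc g p e &
        [/\ ch = tgt g e, ok (tau g p e) & via X D p e = c]) /\
    (forall e, inc g p e -> lec c (via X D p e))
  else
    (forall e, inc g p e -> lec (via X D p e) c /\ (c != 0 -> ok (tau g p e))) /\
    (exists2 e, inc g p e & lec c (via X D p e)).

(* The rank makes the chosen moves lead to [X] even through edges of weight 0. *)
Definition solution X D rank (ch : nat -> nat) : Prop :=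
  forall p, p < nv g ->
    bellman X D (fun x => X x != 0 \/ rank x < rank p) p (D p) (ch p).

(** One value bounds all edges from one side and the other is attained at an edge. As the roles can
    be swapped, the local value is unique. *)
Lemma bellman_lec X D ok ok' p c ch c' ch' :
  bellman X D ok p c ch -> bellman X D ok' p c' ch' -> lec c c'.
Proof.
rewrite /bellman; case: ifP => _ [h1 h2] [h3 h4].
  have [-> |c0] := eqVneq c' 0; first by rewrite /lec eqxx.
  by have [e ie [_ _ <-]] := h3 c0; exact: h2.
by have [e ie le] := h4; have [le' _] := h1 _ ie; have [e' ie' le''] := h2;
  have [l3 _] := h3 _ ie'; exact: lec_trans l3.
Qed.

Lemma sub_bellman X D ok ok' p c ch :
  (forall e, inc g p e -> via X D p e != 0 -> ok (tau g p e) -> ok' (tau g p e)) ->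
  bellman X D ok p c ch -> bellman X D ok' p c ch.
Proof.
move=> okok'; rewrite /bellman; case: ifP => _ [h1 h2]; split=> //.
  move=> c0; have [e ie [h3 h4 h5]] := h1 c0; exists e => //; split=> //.
  by apply: okok'; rewrite // h5.
move=> e ie; have [le h3] := h1 e ie; split=> // c0; apply: okok' (h3 c0) => //.
move: le c0; rewrite /lec; lia.
Qed.

Lemma bellman0 X D ok ok' p ch ch' :
  bellman X D ok p 0 ch -> bellman X D ok' p 0 ch'.
Proof.
by rewrite /bellman; case: ifP => _ [h1 h2]; split=> // e ie; split=> //; case:
  (h1 e ie).
Qed.

(* [c] is the least candidate value of the unsettled vertices below [m], and if
   it is finite, it is the value of [b]. *)
Definition scanned X D m c b ch : Prop :=
  (c != 0 -> [/\ b < nv g, D b = 0 & bellman X D xpredT b c ch]) /\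
  (forall p, p < m -> D p = 0 ->
     exists c' ch', bellman X D xpredT p c' ch' /\ lec c c').

Definition settled D := \sum_(p < nv g) (D p != 0).

(** The invariant after [i] rounds. The threshold [l] lies above all settled values and below all
    finite candidates. The last clause says that every round has settled a vertex, unless the
    unsettled ones are already stuck at infinity. *)
Definition dijkstra X D ch i : Prop :=
  exists (rank : nat -> nat) (l : nat),
  [/\ forall p, p < nv g -> D p != 0 ->
        [/\ D p <= l, rank p < i
          & bellman X D (fun x => X x != 0 \/ rank x < rank p) p (D p) (ch p)],
      forall p, p < nv g -> D p = 0 -> forall c ch',
        bellman X D xpredT p c ch' -> c != 0 -> l <= c
    & i <= settled D \/
      forall p, p < nv g -> D p = 0 -> exists ch', bellman X D xpredT p 0 ch'].

Lemma dijkstra0 X D ch : (forall p, p < nv g -> D p = 0) -> dijkstra X D ch 0.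
Proof.
move=> D0; exists (fun=> 0), 0; split=> //; last by left.
by move=> p pn; rewrite D0.
Qed.

Lemma eq_bellman X D D' ok p c ch :
  {in gtn (nv g), D =1 D'} -> wf_ngame g -> p < nv g ->
  bellman X D ok p c ch -> bellman X D' ok p c ch.
Proof.
move=> eqD [wfg _] pn.
have eqv e : inc g p e -> via X D p e = via X D' p e.
  by move=> ie; rewrite /via /level eqD // inE wfg.
rewrite /bellman; case: ifP => _ [h1 h2]; split.
- by move=> /h1 [e ie [? ? <-]]; exists e; rewrite // -eqv.
- by move=> e ie; rewrite -eqv ?h2.
- by move=> e ie; rewrite -eqv //; exact: h1.
- by have [e ie le] := h2; exists e; rewrite // -eqv.
Qed.

(** Weights are nonnegative, so settling [b] at the least candidate [c] changes [via] only from
    infinity to values at least [c]. Local values at most [c] therefore survive, and [c] becomes the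
    new threshold. *)
Lemma dijkstraS X D D' ch ch' i c b : wf_ngame g ->
  dijkstra X D ch i -> scanned X D (nv g) c b (ch' b) ->
  {in gtn (nv g), D' =1 fun p => if (c != 0) && (p == b) then c else D p} ->
  {in gtn (nv g), ch' =1 fun p => if (c != 0) && (p == b) then ch' b else ch p} ->
  dijkstra X D' ch' i.+1.
Proof.
move=> wfg [rank [l [hs hu hc]]] [scb scu] eqD eqch.
(* With [c] infinite nothing changes, and every unsettled vertex is stuck. *)
have [c0|c0] := eqVneq c 0.
  have eqDD : {in gtn (nv g), D =1 D'} by move=> p pn; rewrite eqD // c0 eqxx.
  exists rank, l; split.
  - move=> p pn; rewrite -eqDD // eqch // c0 eqxx /= => D0.
    have [? ? h] := hs p pn D0; split=> //; first by lia.
    exact: eq_bellman h.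
  - move=> p pn; rewrite -eqDD // => D0 c1 ch1 h.
    apply: (hu p pn D0 c1 ch1); apply: eq_bellman h => //.
    by move=> x xn; rewrite eqDD.
  - right=> p pn; rewrite -eqDD // => D0.
    have [c1 [ch1 [h le]]] := scu p pn D0; exists ch1.
    have -> : 0 = c1 by move: le; rewrite c0 /lec; lia.
    exact: eq_bellman h.
have [bn Db hb] := scb c0.
have lc : l <= c by apply: hu hb c0.
have Dp p : p < nv g -> D' p = if p == b then c else D p.
  by move=> pn; rewrite eqD // c0.
have via_old p e : p < nv g -> inc g p e -> via X D p e != 0 -> via X D' p e =
  via X D p e.
  move=> pn ie; rewrite /via /level Dp ?(wfg.1) //; case: (X _ != 0) => //.
  by case: (tau g p e =P b) => [->|//]; rewrite Db.
(* An edge that becomes finite leads to [b], so it costs at least [c]. *)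
have via_new p e : p < nv g -> inc g p e -> via X D p e = 0 -> via X D' p e !=
  0 -> c <= via X D' p e.
  move=> pn ie; rewrite /via /level Dp ?(wfg.1) //; case: (X _ != 0) => /=;
    first by lia.
  case: (tau g p e =P b) => _; first by rewrite c0; lia.
  by case: (D _ != 0); lia.
have keep ok p v ch1 : p < nv g -> v != 0 -> v <= c ->
    bellman X D ok p v ch1 -> bellman X D' ok p v ch1.
  move=> pn v0 vc; rewrite /bellman; case: ifP => _ [h1 h2]; split.
  - move=> _; have [e ie [? ? h3]] := h1 v0.
    by exists e => //; split=> //; rewrite via_old ?h3.
  - move=> e ie; have := h2 e ie; have := via_old p e pn ie; have := via_new p
    e pn ie.
    by rewrite /lec; lia.
  - move=> e ie; have [h3 h4] := h1 e ie; split=> //; rewrite via_old //.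
    by move: h3; rewrite /lec; lia.
  - have [e ie le] := h2; exists e; rewrite // via_old //.
    by have [h3 _] := h1 e ie; move: h3; rewrite /lec; lia.
(* The round number serves as rank: the value of [b] relies only on targets and on vertices settled
   earlier. *)
pose rank' p := if p == b then i else rank p.
have rankE p : p < nv g -> D p != 0 -> rank' p = rank p.
  by move=> pn D0; rewrite /rank'; case: (p =P b) D0 => [->|//]; rewrite Db.
have okE p e : p < nv g -> inc g p e -> via X D p e != 0 ->
   X (tau g p e) != 0 \/ rank' (tau g p e) = rank (tau g p e) /\ rank (tau g p
     e) < i.
  move=> pn ie; rewrite /via /level; case: (X _ != 0); first by left.
  have tn := wfg.1 _ _ pn ie.
  case: (D (tau g p e) =P 0) => [-> //|/eqP D0 _]; right.
  by rewrite rankE //; have [] := hs _ tn D0.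
exists rank', c; split.
- move=> p pn; rewrite Dp // eqch // c0 /=; case: (p =P b) => [->|/eqP pb].
    move=> _; split=> //; first by rewrite /rank' eqxx.
    apply: keep => //; apply: sub_bellman hb => e ie v0 _.
    by have [|[-> ?]] := okE b e bn ie v0; [left|right; rewrite /rank' eqxx].
  move=> D0; have [h1 h2 h3] := hs p pn D0; split.
  + exact: leq_trans lc.
  + by rewrite /rank' (negPf pb); lia.
  apply: keep => //; first exact: leq_trans lc.
  apply: sub_bellman h3 => e ie v0 [h4|h4]; first by left.
  by have [|[-> ?]] := okE p e pn ie v0; [left|right; rewrite rankE].
- move=> p pn; rewrite Dp //; case: (p =P b) => [_ c00|pb D0 v chv hv v0].
    by rewrite c00 in c0.
  (* On the decisive edge, [via] either was finite before, and the scan gives at least [c], or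
     became finite through [b]. *)
  have [v1 [ch1 [h1 le1]]] := scu p pn D0.
  move: h1 hv; rewrite /bellman; case: ifP => _ [h1 h2] [h3 h4].
    have [e ie [_ _ ve]] := h3 v0.
    have := h2 e ie; have := via_old p e pn ie; have := via_new p e pn ie.
    by move: le1; rewrite /lec; lia.
  have [e ie le] := h2; have [h5 _] := h3 e ie.
  have := via_old p e pn ie; have := via_new p e pn ie.
  by move: le le1 h5; rewrite /lec; lia.
left; have : settled D' = (settled D).+1.
  rewrite /settled (bigD1 (Ordinal bn)) //= Dp // eqxx c0.
  rewrite [in RHS](bigD1 (Ordinal bn)) //= Db /=; congr (_.+1).
  by apply: eq_bigr => p pb; rewrite Dp // ifN.
move=> ->; case: hc => [|stuck]; first by lia.
(* Had an earlier round been stuck, [b] would have no finite candidate. *)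
have [ch1 h1] := stuck b bn Db.
by have := bellman_lec h1 hb; rewrite /lec; lia.
Qed.

(** There are as many rounds as vertices, so an unsettled vertex means that some round settled
    nothing; then the unsettled vertices are stuck and infinity solves their equations. *)
Lemma dijkstra_solution X D ch : dijkstra X D ch (nv g) ->
  exists rank, solution X D rank ch.
Proof.
move=> [rank [l [hs _ hc]]]; exists rank => p pn.
have [D0|D0] := eqVneq (D p) 0; last by have [] := hs p pn D0.
case: hc => [full|stuck]; last first.
  by have [ch' h] := stuck p pn D0; rewrite D0; exact: bellman0 h.
suff : settled D < nv g by lia.
have -> : nv g = \sum_(x < nv g) 1 by rewrite sum1_card card_ord.
rewrite /settled (bigD1 (Ordinal pn)) //= D0 /= [X in _ < X](bigD1 (Ordinal
  pn)) //=.
by rewrite add0n add1n ltnS leq_sum // => x _; case: (D x != 0).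
Qed.

End Bellman.

(** * The solver *)

(* Array names: input arrays start with [a], output arrays with [o], scratch
   arrays with [x] and loop counters with [i]. State [q] and vertex [v] form the
   position [q * #|A| + v], and phase [k] with state [q] the memory state
   [k * #|state D| + q], so that phase [k] occupies the cells from
   [k * (#|state D| * #|A|)] on in the output tables, indexed by position. *)
Notation aSize := 0 (only parsing).
Notation aOwner := 1 (only parsing).
Notation aColor := 2 (only parsing).
Notation aSrc := 3 (only parsing).
Notation aTgt := 4 (only parsing).
Notation aWt := 5 (only parsing).
Notation aStep := 6 (only parsing).
Notation aAcc := 7 (only parsing).
Notation oCount := 8 (only parsing).
Notation oInit := 9 (only parsing).
Notation oUpd := 10 (only parsing).
Notation oNext := 11 (only parsing).
Notation xNum := 12 (only parsing).
Notation xPhases := 13 (only parsing).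
Notation xOff := 14 (only parsing).
Notation xVert := 15 (only parsing).
Notation xRow := 16 (only parsing).
Notation xState := 17 (only parsing).
Notation xSucc := 18 (only parsing).
Notation xGoal := 19 (only parsing).
Notation xMove := 20 (only parsing).
Notation xDist := 21 (only parsing).
Notation xBest := 22 (only parsing).
Notation xNextBase := 23 (only parsing).
Notation xMemBase := 24 (only parsing).
Notation xStepBase := 25 (only parsing).
Notation xMinVal := 26 (only parsing).
Notation xMinPos := 27 (only parsing).
Notation xMinMove := 28 (only parsing).
Notation xCand := 29 (only parsing).
Notation xCandMove := 30 (only parsing).
Notation xWorst := 31 (only parsing).
Notation xWorstPos := 32 (only parsing).
Notation xVal := 33 (only parsing).
Notation xPos := 34 (only parsing).
Notation iState := 40 (only parsing).
Notation iVert := 41 (only parsing).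
Notation iEdge := 42 (only parsing).
Notation iPhase := 43 (only parsing).
Notation iRound := 44 (only parsing).
Notation iPos := 45 (only parsing).

Definition edge_value : loop :=
  Put xPos (Lit 0)
    (Cell xSucc (Add (Cell xRow (scalar iPos)) (Cell aTgt (scalar iEdge))));;
  Cond (Cell xGoal (scalar xPos))
    (Put xVal (Lit 0) (Add (Cell aWt (scalar iEdge)) (Lit 1)))
    (Cond (Cell xDist (scalar xPos))
       (Put xVal (Lit 0)
          (Add (Cell aWt (scalar iEdge)) (Cell xDist (scalar xPos))))
       (Put xVal (Lit 0) (Lit 0))).

(** Infinity is coded 0, so it is replaced first in the minimum of Player 0 and kept for good in the
    maximum of Player 1. In guards, [Add] acts as disjunction and nesting as conjunction. *)
Definition merge : loop :=
  Cond (Cell aOwner (Cell xVert (scalar iPos)))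
    (Cond (scalar xVal)
       (Cond (Add (Eq (scalar xCand) (Lit 0)) (Lt (scalar xVal) (scalar xCand)))
          (Put xCand (Lit 0) (scalar xVal);;
           Put xCandMove (Lit 0) (Cell aTgt (scalar iEdge)))
          Nop)
       Nop)
    (Cond (scalar xVal)
       (Cond (scalar xCand)
          (Cond (Lt (scalar xCand) (scalar xVal))
             (Put xCand (Lit 0) (scalar xVal)) Nop)
          Nop)
       (Put xCand (Lit 0) (Lit 0))).

(** The initial value is neutral: 0, that is infinity, for the minimum of Player 0, and 1, that is
    distance 0, for the maximum of Player 1. *)
Definition candidate : loop :=
  Put xCand (Lit 0) (Defs.Sub (Lit 1) (Cell aOwner (Cell xVert (scalar iPos))));;
  For iEdge aSize 1
    (Cond (Eq (Cell aSrc (scalar iEdge)) (Cell xVert (scalar iPos)))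
       (edge_value;; merge) Nop).

Definition scan_body : loop :=
  Cond (Eq (Cell xDist (scalar iPos)) (Lit 0))
    (candidate;;
     Cond (scalar xCand)
       (Cond (Add (Eq (scalar xMinVal) (Lit 0)) (Lt (scalar xCand) (scalar
         xMinVal)))
          (Put xMinVal (Lit 0) (scalar xCand);;
           Put xMinPos (Lit 0) (scalar iPos);;
           Put xMinMove (Lit 0) (scalar xCandMove))
          Nop)
       Nop)
    Nop.

Definition scan : loop :=
  Put xMinVal (Lit 0) (Lit 0);; For iPos xNum 0 scan_body.

Definition settle : loop :=
  Cond (scalar xMinVal)
    (Put xDist (scalar xMinPos) (scalar xMinVal);;
     Put oNext (Add (scalar xNextBase) (scalar xMinPos)) (scalar xMinMove))
    Nop.

Definition solve : loop := For iRound xNum 0 (scan;; settle).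

(** Moves are preset to an arbitrary edge, so that the table is legal also where the distance
    remains infinite. *)
Definition phase_start : loop :=
  For iPos xNum 0
    (Put xDist (scalar iPos) (Lit 0);;
     Put oNext (Add (scalar xNextBase) (scalar iPos))
       (Cell xMove (Cell xVert (scalar iPos)));;
     Put oUpd (Add (scalar xNextBase) (scalar iPos))
       (Add (scalar xMemBase) (Cell xState (scalar iPos)))).

(** The maximum starts at 1, the code of distance 0, and the test is non-strict, so that the first
    target is recorded even at distance 0. Infinity, once reached, is kept. *)
Definition worst_body : loop :=
  Cond (Cell xGoal (scalar iPos))
    (Cond (scalar xWorst)
       (Cond (Add (Eq (Cell xDist (scalar iPos)) (Lit 0))
                (Lt (scalar xWorst) (Add (Cell xDist (scalar iPos)) (Lit 1))))
          (Put xWorst (Lit 0) (Cell xDist (scalar iPos));;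
           Put xWorstPos (Lit 0) (scalar iPos))
          Nop)
       Nop)
    Nop.

Definition worst : loop :=
  Put xWorst (Lit 0) (Lit 1);; For iPos xNum 0 worst_body.

(** A position carries the state after its own vertex has been read, so a play starts at the [xSucc]
    entry of this cell and not at the cell itself. *)
Definition start_pos : expr :=
  Add (Cell xOff (Cell aSize (Lit 4))) (scalar iVert).

(** Truncated subtraction yields the maximum of the start distance and [xWorst]. A phase in which
    one of them is infinite is passed over. *)
Definition improve_body : loop :=
  Put xPos (Lit 0) (Cell xSucc start_pos);;
  Cond (Cell xDist (scalar xPos))
    (Cond (scalar xWorst)
       (Put xVal (Lit 0)
          (Add (scalar xWorst) (Defs.Sub (Cell xDist (scalar xPos)) (scalar
            xWorst)));;
        Cond (Add (Eq (Cell xBest (scalar iVert)) (Lit 0))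
                (Lt (scalar xVal) (Cell xBest (scalar iVert))))
          (Put xBest (scalar iVert) (scalar xVal);;
           Put oInit (scalar iVert) (Add (scalar xMemBase) (Cell xState start_pos)))
          Nop)
       Nop)
    Nop.

Definition improve : loop := For iVert aSize 0 improve_body.

Definition phase_end : loop :=
  Put xGoal (scalar xWorstPos) (Lit 0);;
  Put xNextBase (Lit 0) (Add (scalar xNextBase) (scalar xNum));;
  Put xMemBase (Lit 0) (Add (scalar xMemBase) (Cell aSize (Lit 2))).

Definition phase : loop := phase_start;; solve;; worst;; improve;; phase_end.

Definition main_loop : loop :=
  For iPhase xPhases 0 phase;; Put oCount (Lit 0) (scalar xMemBase).

(** Multiples of [#|A|] are accumulated by addition, as the machine has no multiplication. *)
Definition offsets : loop :=
  For iState aSize 2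
    (Put xOff (scalar iState) (scalar xNum);;
     Put xNum (Lit 0) (Add (scalar xNum) (Cell aSize (Lit 0)))).

Definition table_row : loop :=
  For iVert aSize 0
    (Put xPos (Lit 0) (Add (Cell xOff (scalar iState)) (scalar iVert));;
     Put xVert (scalar xPos) (scalar iVert);;
     Put xRow (scalar xPos) (Cell xOff (scalar iState));;
     Put xState (scalar xPos)
       (Cell aStep (Add (scalar xStepBase) (Cell aColor (scalar iVert))));;
     Put xSucc (scalar xPos)
       (Add (Cell xOff (Cell xState (scalar xPos))) (scalar iVert));;
     Put xGoal (scalar xPos) (Cell aAcc (scalar iState));;
     Put xPhases (Lit 0) (Add (scalar xPhases) (Cell aAcc (scalar iState)))).

Definition tables : loop :=
  For iState aSize 2
    (table_row;;
     Put xStepBase (Lit 0) (Add (scalar xStepBase) (Cell aSize (Lit 3)))).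

Definition some_moves : loop :=
  For iEdge aSize 1 (Put xMove (Cell aSrc (scalar iEdge)) (Cell aTgt (scalar
    iEdge))).

(** [xPhases] starts at 1 and then counts accepting positions, so the phases outnumber the targets
    that can be deleted. *)
Definition prelude : loop :=
  offsets;; Put xPhases (Lit 0) (Lit 1);; tables;; some_moves.

(** * Effect of the loops on the store *)

Lemma prelude_ok : counters_free prelude && bounds_fixed prelude.
Proof. by []. Qed.

Lemma main_loop_ok : counters_free main_loop && bounds_fixed main_loop.
Proof. by []. Qed.

Definition game_of (s : store) : ngame := {|
  nv := s xNum 0;
  own p := s aOwner (s xVert p) != 0;
  inc p e := (e < s aSize 1) && (s aSrc e == s xVert p);
  tau p e := s xSucc (s xRow p + s aTgt e);
  wt := s aWt;
  tgt := s aTgt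
|}.

Definition game_arrays := [:: aSize; aOwner; aSrc; aTgt; aWt; xNum; xVert;
  xRow; xSucc].

Lemma eq_game_of s t : {in game_arrays, s =1 t} -> game_of s = game_of t.
Proof. by move=> st; rewrite /game_of !st. Qed.

Lemma sub_notin (l l' : seq nat) a :
  all [in l] l' -> a \notin l -> a \notin l'.
Proof. by move=> /allP ll; apply: contra; exact: ll. Qed.

Lemma run_then l1 l2 s : run (l1;; l2) s = run l2 (run l1 s).
Proof. by []. Qed.

Lemma run_condT e l1 l2 s : eval s e != 0 -> run (Cond e l1 l2) s = run l1 s.
Proof. by move=> /= ->. Qed.

Lemma run_condF e l1 l2 s : eval s e = 0 -> run (Cond e l1 l2) s = run l2 s.
Proof. by move=> /= ->. Qed.

Lemma run_edge_value s :
  run edge_value s xVal 0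
  = via (game_of s) (s xGoal) (s xDist) (s iPos 0) (s iEdge 0).
Proof.
rewrite /via /level /= /set_cell /=.
case: (s xGoal _ =P 0) => _ //=.
by case: (s xDist _ =P 0).
Qed.

Lemma run_merge s : let v := s xVal 0 in let c := s xCand 0 in
  if s aOwner (s xVert (s iPos 0)) != 0 then
    if (v != 0) && ((c == 0) || (v < c)) then
      run merge s xCand 0 = v /\ run merge s xCandMove 0 = s aTgt (s iEdge 0)
    else run merge s xCand 0 = c /\ run merge s xCandMove 0 = s xCandMove 0
  else [/\ lec v (run merge s xCand 0), lec c (run merge s xCand 0)
         & run merge s xCand 0 = c \/ run merge s xCand 0 = v].
Proof.
move=> /=; case: (s aOwner _ =P 0) => _ /=.
  case: (s xVal 0 =P 0) => [v0|v0] /=.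
    by rewrite /set_cell /= /lec; split=> //; right.
  case: (s xCand 0 =P 0) => [c0|c0] /=; first by rewrite c0 /lec; split=> //; left.
  case: ltnP => /= h; rewrite /set_cell /= /lec; split; try lia; by [left|right].
case: (s xVal 0 =P 0) => //= _; case: (s xCand 0 =P 0) => //= _.
by case: (s xVal 0 < s xCand 0).
Qed.

Lemma run_candidate s p : s iPos 0 = p -> (exists e, inc (game_of s) p e) ->
  bellman (game_of s) (s xGoal) (s xDist) xpredT p
    (run candidate s xCand 0) (run candidate s xCandMove 0).
Proof.
have [g gE] : exists g, game_of s = g by exists (game_of s).
rewrite gE => sp hinc; set v := via g (s xGoal) (s xDist) p.
rewrite /candidate run_then; set s1 := run (Put _ _ _) s.
set f := For _ _ _ _.
(* For Player 1 the candidate may still be the initial 1, attained by no edge seen so far. As the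
   least code it is below [via] of any edge, and [p] has one. *)
pose I k (t : store) := let c := t xCand 0 in
  if own g p then
    (c != 0 -> exists2 e, (e < k) && inc g p e & t xCandMove 0 = tgt g e /\ v e
      = c) /\
    (forall e, e < k -> inc g p e -> lec c (v e))
  else (forall e, e < k -> inc g p e -> lec (v e) c) /\
    (c = 1 \/ exists2 e, (e < k) && inc g p e & lec c (v e)).
have : I (s1 aSize 1) (run f s1).
  apply: run_for.
    rewrite /I; have -> : set_cell s1 iEdge 0 0 xCand 0 = 1 - s aOwner (s xVert p).
      by rewrite set_cell_neq // /s1 /= sp.
    by rewrite -gE /=; case: ifP => o0; split=> //; [lia|left; lia].
  move=> k t kE tk fr.
  have fr' b : b \notin iEdge :: writes (edge_value;; merge) -> t b = s b.
    by move=> bw; rewrite fr // /s1 run_frame // (sub_notin _ bw).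
  have gt : game_of t = g by rewrite -gE; apply: eq_game_of => a ag; apply:
    fr'; move: a ag; apply/allP.
  have vk : run edge_value t xVal 0 = v k.
    by rewrite run_edge_value gt tk !fr' // sp.
  have incE : inc g p k = (s aSrc k == s xVert p) by rewrite -gE /= kE.
  have condE : eval t (Eq (Cell aSrc (scalar iEdge)) (Cell xVert (scalar
    iPos))) = inc g p k.
    by rewrite incE /= tk !fr' // sp.
  case ik : (inc g p k) condE => condE; last first.
    rewrite run_condF // [run Nop _]/= /I !set_cell_neq //; case: ifP => _ [h1
      h2]; split.
    - by move=> /h1 [e /andP[ek ie] he]; exists e => //; rewrite ie ltnW.
    - move=> e; rewrite ltnS leq_eqVlt => /orP[/eqP->|]; [by rewrite ik|exact: h2].
    - move=> e; rewrite ltnS leq_eqVlt => /orP[/eqP->|]; [by rewrite ik|exact: h1].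
    - case: h2 => [|[e /andP[ek ie] he]]; [by left|right; exists e => //].
      by rewrite ie ltnW.
  rewrite run_condT ?condE // run_then; have := run_merge (run edge_value t).
  have fe a : a \notin iEdge :: writes (edge_value;; merge) -> run edge_value t
    a = s a.
    by move=> aw; rewrite run_frame ?fr' // (sub_notin _ aw).
  have fc a : a \in [:: xCand; xCandMove; iEdge] -> run edge_value t a = t a.
    by move=> aw; rewrite run_frame //; move: a aw; apply/allP.
  rewrite vk (fe aOwner) // (fe xVert) // (fe iPos) // (fe aTgt) // !fc // sp tk.
  rewrite /I !set_cell_neq // -[s aOwner _ != 0]/(own (game_of s) p) gE -[s
    aTgt _]/(tgt (game_of s) k) gE.
  case: ifP => _; last first.
    move=> [vc cc cE] [h1 h2]; split.
      move=> e; rewrite ltnS leq_eqVlt => /orP[/eqP->|ek] ie //.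
      exact: lec_trans (h1 e ek ie) cc.
    case: cE => ->; last by right; exists k; rewrite ?ltnSn ?lec_refl.
    case: h2 => [|[e /andP[ek ie] he]]; first by left.
    right; exists e => //; rewrite ie andbT; exact: ltnW.
  case: ifP => cond [cE mE] [h1 h2]; rewrite cE mE; split.
  - by exists k; rewrite ?ltnSn.
  - move=> e; rewrite ltnS leq_eqVlt => /orP[/eqP->|ek] ie; first exact: lec_refl.
    by have := h2 e ek ie; move: cond; rewrite /lec; lia.
  - by move=> /h1 [e /andP[ek ie] he]; exists e => //; rewrite ie ltnW.
  - move=> e; rewrite ltnS leq_eqVlt => /orP[/eqP->|ek] ie; last exact: h2.
    by move: cond; rewrite /lec; lia.
have s1E : s1 aSize 1 = s aSize 1 by [].
rewrite s1E /I /bellman -/v; case: ifP => _ [h1 h2]; split.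
- by move=> /h1 [e /andP[ek ie] [? ?]]; exists e.
- by move=> e ie; apply: h2 => //; move: ie; rewrite -gE => /andP[].
- by move=> e ie; split=> //; apply: h1 => //; move: ie; rewrite -gE => /andP[].
- case: h2 => [c1|[e /andP[ek ie] he]]; last by exists e.
  by case: hinc => e ie; exists e => //; rewrite c1 /lec; lia.
Qed.

Lemma game_of_frame l s t :
  all (fun a => a \notin writes l) game_arrays ->
  (forall a, a \notin writes l -> t a = s a) -> game_of t = game_of s.
Proof. by move=> /allP al ts; apply: eq_game_of => a /al; apply: ts. Qed.

Lemma run_scan s (g := game_of s) :
  (forall p, p < nv g -> exists e, inc g p e) ->
  scanned g (s xGoal) (s xDist) (nv g) (run scan s xMinVal 0)
    (run scan s xMinPos 0) (run scan s xMinMove 0).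
Proof.
rewrite {}/g; have [g gE] : exists g, game_of s = g by exists (game_of s).
rewrite gE => hinc; rewrite /scan run_then; set s1 := run (Put _ _ _) s.
pose I k (t : store) := scanned g (s xGoal) (s xDist) k
   (t xMinVal 0) (t xMinPos 0) (t xMinMove 0).
have nE : nv g = s xNum 0 by rewrite -gE.
have : I (s1 xNum 0) (run (For iPos xNum 0 scan_body) s1); last first.
  by rewrite /I [s1 xNum]set_cell_neq // -nE.
apply: run_for; first by split.
move=> k t kn tk fr; have {}kn : k < nv g by rewrite nE.
have fr' b : b \notin xMinVal :: iPos :: writes scan_body -> t b = s b.
  by move=> bw; rewrite fr /s1 ?run_frame //; apply: sub_notin bw.
have gt : game_of t = g.
  by rewrite -gE; apply: (@game_of_frame (Then (Put xMinVal (Lit 0) (Lit 0))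
    (For iPos 0 0 scan_body))).
rewrite /I /scan_body !set_cell_neq //.
have e0 : eval t (Eq (Cell xDist (scalar iPos)) (Lit 0)) = (s xDist k == 0).
  by rewrite /= tk fr'.
have [Dk|Dk] := eqVneq (s xDist k) 0; last first.
  rewrite run_condF ?e0 ?(negPf Dk) // [run Nop t]/=.
  move=> [h1 h2]; split=> // p; rewrite ltnS leq_eqVlt => /orP[/eqP->|]; last
    exact: h2.
  by move=> D0; rewrite D0 in Dk.
rewrite run_condT ?e0 ?Dk // run_then.
have := run_candidate tk; rewrite gt (fr' xGoal) // (fr' xDist) // => /(_ (hinc
  k kn)).
have fc b : b \notin writes candidate -> run candidate t b = t b by exact:
  run_frame.
move: (run candidate t) fc => u fc hb [h1 h2].
have old : (forall c, lec c (t xMinVal 0) -> lec c (u xCand 0) ->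
    forall p, p < k.+1 -> s xDist p = 0 -> exists c' ch',
      bellman g (s xGoal) (s xDist) xpredT p c' ch' /\ lec c c').
  move=> c c1 c2 p; rewrite ltnS leq_eqVlt => /orP[/eqP->|pk] D0.
    by exists (u xCand 0), (u xCandMove 0).
  by have [c' [ch' [? le]]] := h2 p pk D0; exists c', ch'; split=> //; exact:
    lec_trans le.
have [c0|c0] := eqVneq (u xCand 0) 0.
  rewrite run_condF // [run Nop u]/= (fc xMinVal) // (fc xMinPos) // (fc
    xMinMove) //; split=> //.
  by apply: old; rewrite ?c0 // lec_refl.
rewrite run_condT //.
have [cond|cond] := boolP ((u xMinVal 0 == 0) || (u xCand 0 < u xMinVal 0)).
  rewrite run_condT /=; last by move: cond; case: eqP => //; case: ltnP.
  rewrite /set_cell /= (fc iPos) // tk; split=> [_|]; first by split.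
  by apply: old; rewrite ?lec_refl //; move: cond; rewrite (fc xMinVal) //
    /lec; lia.
rewrite run_condF /=; last by move: cond; case: eqP => //; case: ltnP.
rewrite (fc xMinVal) // (fc xMinPos) // (fc xMinMove) //; split=> //; apply:
  old; rewrite ?lec_refl //.
by move: cond; rewrite (fc xMinVal) // /lec; lia.
Qed.

Lemma run_settle s (c := s xMinVal 0) (b := s xMinPos 0) (k := s xNextBase 0) :
  run settle s xDist =1 (fun p => if (c != 0) && (p == b) then c else s xDist p) /\
  run settle s oNext =1
    (fun i => if (c != 0) && (i == k + b) then s xMinMove 0 else s oNext i).
Proof.
rewrite /settle {}/c {}/b {}/k; have [c0|c0] := eqVneq (s xMinVal 0) 0.
  by rewrite run_condF.
by rewrite run_condT //; split=> p; rewrite /= /set_cell /=.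
Qed.

Definition legal g (next : nat -> nat) : Prop :=
  forall p, p < nv g -> own g p -> exists2 e, inc g p e & next p = tgt g e.

(** [dijkstra] is the invariant of the rounds. Moves are written only from [k] on, so the tables of
    earlier phases survive. *)
Lemma run_solve s (g := game_of s) (k := s xNextBase 0) (t := run solve s) :
  wf_ngame g ->
  (forall p, p < nv g -> s xDist p = 0) -> legal g (fun p => s oNext (k + p)) ->
  [/\ exists rank, solution g (s xGoal) (t xDist) rank (fun p => t oNext (k + p)),
      legal g (fun p => t oNext (k + p))
    & forall i, i < k -> t oNext i = s oNext i].
Proof.
rewrite {}/t {}/g; have [g gE] : exists g, game_of s = g by exists (game_of s).
rewrite gE => wfg D0 leg; have hinc := wfg.2.
pose I j (t : store) :=
  [/\ dijkstra g (s xGoal) (t xDist) (fun p => t oNext (k + p)) j,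
      legal g (fun p => t oNext (k + p))
    & forall i, i < k -> t oNext i = s oNext i].
have nE : nv g = s xNum 0 by rewrite -gE.
suff : I (s xNum 0) (run solve s).
  rewrite -nE => -[h1 h2 h3]; split=> //; exact: dijkstra_solution h1.
apply: run_for; first by split=> //; apply: dijkstra0.
move=> j t _ _ fr [hd hl hi]; rewrite run_then.
have gt : game_of t = g.
  by rewrite -gE; apply: (@game_of_frame (For iRound 0 0 (scan;; settle))).
have := @run_scan t; rewrite gt (fr xGoal) // => /(_ hinc).
have fs b : b \notin writes scan -> run scan t b = t b by exact: run_frame.
move: (run scan t) fs => u fs hs.
have [] := run_settle u; rewrite (fs xDist) // (fs oNext) // (fs xNextBase) //
  (fr xNextBase) // -/k.
move=> rD rN; rewrite /I !set_cell_neq //; split.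
- have hs' : scanned g (s xGoal) (t xDist) (nv g) (u xMinVal 0) (u xMinPos 0)
      (run settle u oNext (k + u xMinPos 0)).
    case: hs => h1 h2; split=> // c0; have := h1 c0.
    by rewrite rN c0 eqxx.
  apply: (dijkstraS wfg hd hs') => p _; first by rewrite rD.
  by rewrite rN eqn_add2l; case: ifP => // /andP[c0 _]; rewrite rN c0 eqxx.
- move=> p pn op; rewrite rN eqn_add2l; case: ifP => [/andP[c0 /eqP pb]|_];
  last exact: hl.
  have [_ _] := hs.1 c0; rewrite /bellman -pb op => -[/(_ c0) [e ie [-> _ _]] _].
  by exists e.
- move=> i ik; rewrite rN hi //; case: ifP => // /andP[_ /eqP iE].
  by move: ik; rewrite iE; lia.
Qed.

Lemma run_phase_start s (k := s xNextBase 0) (t := run phase_start s) :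
  [/\ forall p, p < s xNum 0 ->
        [/\ t xDist p = 0, t oNext (k + p) = s xMove (s xVert p)
          & t oUpd (k + p) = s xMemBase 0 + s xState p],
      forall i, i < k -> t oNext i = s oNext i
    & forall i, i < k -> t oUpd i = s oUpd i].
Proof.
pose I j (t : store) :=
  [/\ forall p, p < j ->
        [/\ t xDist p = 0, t oNext (k + p) = s xMove (s xVert p)
          & t oUpd (k + p) = s xMemBase 0 + s xState p],
      forall i, i < k -> t oNext i = s oNext i
    & forall i, i < k -> t oUpd i = s oUpd i].
apply: (@run_for I); first by [].
move=> j u _ uj fr [h1 h2 h3].
split; rewrite /= /set_cell /= uj (fr xNextBase) // ?(fr xMove) // ?(fr xVert)
  // ?(fr xMemBase) // ?(fr xState) // -/k => p.
- rewrite eqn_add2l ltnS leq_eqVlt; case: (p =P j) => [->//|_] /= pj.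
  exact: h1.
- by move=> pk; rewrite ifN ?h2 //; lia.
- by move=> pk; rewrite ifN ?h3 //; lia.
Qed.

Lemma run_worst s (X := s xGoal) (D := s xDist) (t := run worst s) :
  (forall p, p < s xNum 0 -> X p != 0 -> lec (D p) (t xWorst 0)) /\
  (t xWorst 0 = 1 /\ (forall p, p < s xNum 0 -> X p = 0) \/
   [/\ t xWorstPos 0 < s xNum 0, X (t xWorstPos 0) != 0
     & D (t xWorstPos 0) = t xWorst 0]).
Proof.
rewrite {}/t /worst run_then; set s1 := run (Put _ _ _) s.
pose I j (t : store) :=
  (forall p, p < j -> X p != 0 -> lec (D p) (t xWorst 0)) /\
  (t xWorst 0 = 1 /\ (forall p, p < j -> X p = 0) \/
   [/\ t xWorstPos 0 < j, X (t xWorstPos 0) != 0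
     & D (t xWorstPos 0) = t xWorst 0]).
apply: (@run_for I); first by split=> //; left.
move=> j t jn tj fr.
have fr' b : b \notin xWorst :: iPos :: writes worst_body -> t b = s b.
  by move=> bw; rewrite fr /s1 ?run_frame //; apply: sub_notin bw.
(* A target may be skipped if it is dominated and the maximum has left its initial value 1, for then
   some target is recorded. *)
have skip : (X j != 0 -> lec (D j) (t xWorst 0) /\ t xWorst 0 != 1) -> I j t ->
  I j.+1 t.
  move=> Xj [h1 h2]; split.
    move=> p; rewrite ltnS leq_eqVlt => /orP[/eqP->|]; last exact: h1.
    by move=> /Xj [].
  case: h2 => [[w1 h]|[h3 h4 h5]]; last by right; split=> //; exact: ltnW.
  left; split=> // p; rewrite ltnS leq_eqVlt => /orP[/eqP->|]; last exact: h.
  by apply/eqP; case: eqP => // /eqP /Xj []; rewrite w1.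
have IE (u : store) : I j.+1 u -> I j.+1 (set_cell u iPos 0 j.+1).
  by rewrite /I !set_cell_neq.
move=> It; apply: IE; rewrite /worst_body.
have e0 : eval t (Cell xGoal (scalar iPos)) = X j by rewrite /= tj fr'.
have [Xj|Xj] := eqVneq (X j) 0.
  by rewrite run_condF ?e0 //; apply: skip It; rewrite Xj.
rewrite run_condT ?e0 //.
have [w0|w0] := eqVneq (t xWorst 0) 0.
  by rewrite run_condF //; apply: skip It; rewrite w0 /lec.
rewrite run_condT //.
have [cond|cond] := boolP ((D j == 0) || (t xWorst 0 <= D j)).
  rewrite run_condT /=; last by rewrite tj fr' // addn1 ltnS; move: cond; case:
    eqP => //; case: leqP.
  rewrite /I /set_cell /= tj fr' //; case: It => h1 h2; split.
    move=> p; rewrite ltnS leq_eqVlt => /orP[/eqP->|pj Xp]; first by rewrite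
      lec_refl.
    by have := h1 p pj Xp; move: cond; rewrite /lec /D; lia.
  by right; split.
rewrite run_condF /=; last by rewrite tj fr' // addn1 ltnS; move: cond; case:
  eqP => //; case: leqP.
apply: skip (It) => _; split; first by move: cond; rewrite /lec /D; lia.
case: It => _ [[w1 _]|[h3 h4 h5]]; move: cond; rewrite /D; lia.
Qed.

Definition start (s : store) v := s xSucc (s xOff (s aSize 4) + v).

Definition start_state (s : store) v := s xState (s xOff (s aSize 4) + v).

(** The second clause serves optimality; the third shows that the memory state stored with a new
    bound belongs to a phase that achieves it. *)
Lemma run_improve s (t := run improve s) v :
  v < s aSize 0 ->
  [/\ lec (t xBest v) (s xBest v),
      forall x, x != 0 -> lec (s xDist (start s v)) x -> lec (s xWorst 0) x ->
        lec (t xBest v) x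
    & t xBest v = s xBest v /\ t oInit v = s oInit v \/
      [/\ t xBest v != 0, t oInit v = s xMemBase 0 + start_state s v,
          lec (s xDist (start s v)) (t xBest v) & lec (s xWorst 0) (t xBest v)]].
Proof.
pose J (t : store) v :=
  [/\ lec (t xBest v) (s xBest v),
      forall x, x != 0 -> lec (s xDist (start s v)) x -> lec (s xWorst 0) x ->
        lec (t xBest v) x
    & t xBest v = s xBest v /\ t oInit v = s oInit v \/
      [/\ t xBest v != 0, t oInit v = s xMemBase 0 + start_state s v,
          lec (s xDist (start s v)) (t xBest v) & lec (s xWorst 0) (t xBest v)]].
pose I j (t : store) := (forall v, v < j -> J t v) /\
  (forall v, j <= v -> t xBest v = s xBest v /\ t oInit v = s oInit v).
suff : I (s aSize 0) t by move=> [h _]; exact: h.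
apply: run_for; first by [].
move=> {v t} j t jn tj fr [h1 h2].
have IE (u : store) : I j.+1 u -> I j.+1 (set_cell u iVert 0 j.+1).
  by rewrite /I /J !set_cell_neq.
apply: IE; have [bj ij] := h2 j (leqnn j).
have skip (u : store) : u xBest = t xBest -> u oInit = t oInit ->
   (forall x, x != 0 -> lec (s xDist (start s j)) x -> lec (s xWorst 0) x ->
        lec (s xBest j) x) -> I j.+1 u.
  move=> ub ui h; split; last by move=> v jv; rewrite ub ui; apply: h2; exact: ltnW.
  move=> v; rewrite ltnS leq_eqVlt => /orP[/eqP->|vj]; last by rewrite /J ub
    ui; exact: h1.
  by rewrite /J ub ui bj ij lec_refl; split=> //; left.
rewrite /improve_body run_then; set u := run (Put _ _ _) t.
have ux : u xPos 0 = start s j.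
  by rewrite /u /= /set_cell /= (fr xSucc) // (fr xOff) // (fr aSize) // tj.
have uf b : b != xPos -> u b = t b by move=> bx; rewrite /u /= set_cell_neq.
have e0 : eval u (Cell xDist (scalar xPos)) = s xDist (start s j).
  by rewrite /= ux uf // (fr xDist).
have [D0|D0] := eqVneq (s xDist (start s j)) 0.
  rewrite run_condF ?e0 //; apply: skip; rewrite ?(uf xBest) ?(uf oInit) //.
  by move=> x x0; rewrite D0 /lec; lia.
rewrite run_condT ?e0 //.
have e1 : eval u (scalar xWorst) = s xWorst 0 by rewrite /= uf // (fr xWorst).
have [W0|W0] := eqVneq (s xWorst 0) 0.
  rewrite run_condF ?e1 //; apply: skip; rewrite ?(uf xBest) ?(uf oInit) //.
  by move=> x x0; rewrite W0 /lec; lia.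
rewrite run_condT ?e1 // run_then; set w := run (Put _ _ _) u.
have wx : w xVal 0 = maxn (s xDist (start s j)) (s xWorst 0).
  by move: e0 e1; rewrite /w /= /set_cell /= maxnE => -> ->; lia.
have wf b : b != xPos -> b != xVal -> w b = t b.
  by move=> b1 b2; rewrite /w /= set_cell_neq // uf.
have wbest : w xBest (w iVert 0) = s xBest j by rewrite !wf // tj bj.
have [cond|cond] := boolP ((s xBest j == 0) || (w xVal 0 < s xBest j)).
  rewrite run_condT /=; last by rewrite wbest; move: cond; case: eqP => //;
    case: ltnP.
  rewrite /I /J /= /set_cell /= (wf iVert) // tj (wf xMemBase) // (wf xState)
    // (wf xOff) //
    (wf aSize) // (wf oInit) // (wf xBest) // (fr xMemBase) // (fr xState) //
      (fr xOff) // (fr aSize) // wx.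
  rewrite wx in cond; split=> v /=; last first.
    by move=> jv; rewrite ifN ?ifN; [apply: h2; exact: ltnW|lia|lia].
  rewrite ltnS leq_eqVlt; case: (v =P j) => [-> _|_] /=; last exact: h1.
  by split; [|move=> x|right; split]; rewrite // /lec; move: cond D0 W0; lia.
rewrite run_condF /=; last by rewrite wbest; move: cond; case: eqP => //; case:
  ltnP.
apply: skip; rewrite ?wf //.
by move=> x x0; move: cond; rewrite wx /lec; lia.
Qed.

(** * The invariant of the phases *)

Definition ready (s : store) : Prop :=
  [/\ wf_ngame (game_of s),
      forall p, p < s xNum 0 ->
        exists2 e, inc (game_of s) p e & s xMove (s xVert p) = s aTgt e,
      forall v, v < s aSize 0 -> start s v < s xNum 0,
      \sum_(p < s xNum 0) (s xGoal p != 0) < s xPhases 0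
    & [/\ s xNextBase 0 = 0, s xMemBase 0 = 0,
          forall v, s xBest v = 0 & forall v, s oInit v = 0]].

(* [R] is to be the set of accepting positions that occur under some strategy
   of value at most [N] from [v]. *)
Definition answered (s : store) v (R : nat -> Prop) N : Prop :=
  (forall p, p < s xNum 0 -> R p -> s xGoal p != 0) /\
  forall X D rank ch, solution (game_of s) X D rank ch ->
    (forall p, p < s xNum 0 -> R p -> X p != 0) ->
    lec (D (start s v)) N.+1 /\
    forall p, p < s xNum 0 -> R p -> lec (D p) N.+1.

(** A certificate that the moves [ch] achieve [b] from [v]: from the start and from every target in
    [X], a next target is forced within [b]. *)
Definition secured (s : store) v ch b : Prop :=
  exists X D rank,
  [/\ solution (game_of s) X D rank ch,
      forall p, p < s xNum 0 -> X p != 0 -> s xGoal p != 0 /\ lec (D p) b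
    & lec (D (start s v)) b].

(** The count of remaining targets makes them run out in time. The last clause carries optimality:
    as long as the stored bound is worse than [N], no element of [R] has been deleted. *)
Definition phases_done (s : store) k (t : store) : Prop :=
  let n := s xNum 0 in let nq := s aSize 2 in
  [/\ [/\ t xNextBase 0 = k * n, t xMemBase 0 = k * nq,
          forall p, p < n -> t xGoal p != 0 -> s xGoal p != 0
        & k + \sum_(p < n) (t xGoal p != 0) < s xPhases 0 \/
          forall p, p < n -> t xGoal p = 0],
      forall i p, i < k -> p < n -> t oUpd (i * n + p) = i * nq + s xState p,
      forall i, i < k -> legal (game_of s) (fun p => t oNext (i * n + p)),
      forall v, v < s aSize 0 ->
        (t xBest v = 0 /\ t oInit v = 0) \/
        t xBest v != 0 /\ (exists i, [/\ i < k, t oInit v = i * nq + start_state s v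
            & secured s v (fun p => t oNext (i * n + p)) (t xBest v)])
    & forall v R N, v < s aSize 0 -> answered s v R N ->
        lec (t xBest v) N.+1 \/ forall p, p < n -> R p -> t xGoal p != 0].

Lemma eq_solution g X D rank ch ch' :
  (forall p, p < nv g -> ch p = ch' p) ->
  solution g X D rank ch -> solution g X D rank ch'.
Proof. by move=> e h p pn; rewrite -e //; apply: h. Qed.

Lemma secured_eq s v ch ch' b : (forall p, p < s xNum 0 -> ch p = ch' p) ->
  secured s v ch b -> secured s v ch' b.
Proof.
move=> e [X [D [rank [h1 h2 h3]]]]; exists X, D, rank; split=> //.
exact: eq_solution h1.
Qed.

Lemma run_phase s k t : ready s ->
  (forall b, b \notin iPhase :: writes phase -> t b = s b) ->
  phases_done s k t -> phases_done s k.+1 (run phase t).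
Proof.
move=> [wfg mv st _ _] fr.
set n := s xNum 0; set nq := s aSize 2.
have gt : game_of t = game_of s by apply: (@game_of_frame (For iPhase 0 0 phase)).
move=> [[kn kq gs cnt] upd leg best low].
rewrite (_ : run phase t =
  run phase_end (run improve (run worst (run solve (run phase_start t))))) //.
have := run_phase_start t; have f1 b : b \notin writes phase_start -> run
  phase_start t b = t b by exact: run_frame.
move: (run phase_start t) f1 => t1 f1; rewrite kn kq (fr xNum) // (fr xMove) //
  (fr xVert) // (fr xState) // -/n.
move=> [new1 oldN1 oldU1].
have g1 : game_of t1 = game_of s by rewrite -gt; apply: (@game_of_frame
  phase_start).
have leg1 : legal (game_of s) (fun p => t1 oNext (k * n + p)).
  move=> p pn op; have [_ -> _] := new1 p pn; have [e ie me] := mv p pn.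
  by exists e.
have := @run_solve t1; rewrite g1 (f1 xNextBase) // kn -/n (f1 xGoal) //.
move=> /(_ wfg (fun p pn => let: And3 h _ _ := new1 p pn in h) leg1).
have f2 b : b \notin writes solve -> run solve t1 b = t1 b by exact: run_frame.
move: (run solve t1) f2 => t2 f2 [[rank sol] leg2 oldN2].
have := run_worst t2; have f3 b : b \notin writes worst -> run worst t2 b = t2
  b by exact: run_frame.
move: (run worst t2) f3 => t3 f3; rewrite (f2 xGoal) // (f1 xGoal) // (f2 xNum)
  // (f1 xNum) // (fr xNum) // -/n.
move=> [worst_ub worst_at].
have := run_improve; move=> /(_ t3).
have f4 b : b \notin writes improve -> run improve t3 b = t3 b by exact: run_frame.
move: (run improve t3) f4 => t4 f4.
rewrite /start /start_state.
have f30 b : b \notin writes phase_start ++ writes solve ++ writes worst -> t3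
  b = t b.
  by move=> h; rewrite f3 ?f2 ?f1 //; apply: sub_notin h.
have fs b : b \notin iPhase :: writes phase -> t3 b = s b.
  move=> h; rewrite f30 ?fr //; exact: sub_notin h.
rewrite (fs aSize) // (f30 xBest) // (f3 xDist) // (fs xSucc) // (fs xOff) //.
rewrite (f30 oInit) // (f30 xMemBase) // kq (fs xState) // -/nq => imp.
set t7 := run phase_end t4.
have f7 b : b \notin [:: xGoal; xNextBase; xMemBase] -> t7 b = t4 b.
  by move=> h; rewrite /t7 run_frame //; apply: sub_notin h.
have f73 b : b \notin [:: xGoal; xNextBase; xMemBase] ++ writes improve -> t7 b
  = t3 b.
  by move=> h; rewrite f7 ?f4 //; apply: sub_notin h.
have goal7 p : t7 xGoal p = if p == t3 xWorstPos 0 then 0 else t xGoal p.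
  by rewrite /t7 /= /set_cell /= !f4 // (f30 xGoal).
have goal_sub p : t7 xGoal p != 0 -> t xGoal p != 0.
  by rewrite goal7; case: ifP.
have next_old i p : i < k -> p < n -> t7 oNext (i * n + p) = t oNext (i * n + p).
  move=> ik pn; have lt : i * n + p < k * n by nia.
  by rewrite f73 // f3 // oldN2 // oldN1.
have upd7 i : t7 oUpd i = t1 oUpd i by rewrite f73 // f3 // f2.
have next7 i : t7 oNext i = t2 oNext i by rewrite f73 // f3.
rewrite /phases_done -/n -/nq; split.
- split.
  + by rewrite /t7 /= /set_cell /= !f4 // (f30 xNextBase) // (fs xNum) // kn
    mulSn addnC.
  + by rewrite /t7 /= /set_cell /= !f4 // (f30 xMemBase) // (fs aSize) // kq
    mulSn addnC.
  + by move=> p pn /goal_sub; apply: gs.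
  (* While targets remain, the phase deletes one. Afterwards the stale [xWorstPos] is harmless, all
     flags being 0 already. *)
  case: cnt => [cnt|Z]; last by right=> p pn; rewrite goal7 Z //; case: ifP.
  case: worst_at => [[_ Z]|[un Xu _]]; first by right=> p pn; rewrite goal7 Z
    //; case: ifP.
  left; apply: leq_trans cnt; rewrite addSn ltnS ltn_add2l.
  rewrite (bigD1 (Ordinal un)) //= goal7 eqxx /= [X in _ < X](bigD1 (Ordinal
    un)) //= Xu.
  by rewrite add0n add1n ltnS leq_sum // => p _; rewrite goal7; case: ifP.
- move=> i p; rewrite ltnS leq_eqVlt upd7 => /orP[/eqP->|ik] pn; first by have
  [_ _ ->] := new1 p pn.
  by rewrite oldU1 ?upd //; nia.
- move=> i; rewrite ltnS leq_eqVlt => /orP[/eqP->|ik] p pn op; rewrite ?next7;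
  first exact: leg2.
  by rewrite -next7 next_old //; exact: leg.
- move=> v vn; have [_ _ hv] := imp v vn.
  rewrite (f7 xBest) // (f7 oInit) //; case: hv => [[-> ->]|[b0 iE lD lW]].
    case: (best v vn) => [|[b0 [i [ik iE sec]]]]; [by left|right; split=> //].
    exists i; split=> //; first exact: ltnW.
    by apply: secured_eq sec => p pn; rewrite next_old.
  right; split=> //; exists k; split=> //.
  exists (t xGoal), (t2 xDist), rank; split=> //.
    by apply: eq_solution sol => p _; rewrite next7.
  by move=> p pn Xp; split; [exact: gs|exact: lec_trans (worst_ub p pn Xp) lW].
- move=> v R N vn ans; have [le1 le2 _] := imp v vn; rewrite (f7 xBest) //.
  case: (low v R N vn ans) => [le|RX]; first by left; exact: lec_trans le.
  (* Start and [R] have distance at most [N] in this phase. Hence either the phase is as good as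
     [N], or the worst distance exceeds [N] and the deleted position lies outside [R]. *)
  have [ls lR] := ans.2 _ _ _ _ sol RX.
  have [W|W] := boolP (lec (t3 xWorst 0) N.+1); first by left; apply: le2.
  right=> p pn Rp; rewrite goal7; case: (p =P _) => [pu|_]; last exact: RX.
  case: worst_at => [[w1 _]|[_ _ wE]]; first by move: W; rewrite w1 /lec.
  by move: W; rewrite -wE -pu lR.
Qed.

Lemma run_main_loop s (t := run main_loop s) : ready s ->
  let n := s xNum 0 in let nq := s aSize 2 in let k := s xPhases 0 in
  [/\ t oCount 0 = k * nq,
      forall i p, i < k -> p < n -> t oUpd (i * n + p) = i * nq + s xState p,
      forall i, i < k -> legal (game_of s) (fun p => t oNext (i * n + p))
    & forall v, v < s aSize 0 -> exists2 b,
        (b = 0 /\ t oInit v = 0) \/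
        b != 0 /\ (exists i, [/\ i < k, t oInit v = i * nq + start_state s v
            & secured s v (fun p => t oNext (i * n + p)) b])
       & forall R N, answered s v R N -> lec b N.+1].
Proof.
move=> rs n nq k; rewrite {}/t /main_loop run_then.
set f := For _ _ _ _.
have : phases_done s k (run f s).
  apply: run_for.
    have [_ _ _ cnt [h1 h2 h3 h4]] := rs.
    rewrite /phases_done !set_cell_neq //; split=> //.
    - by split=> //; left.
    - by move=> v _; left.
    - by move=> v R N vn [h _]; right.
  move=> i t ik ti fr /(run_phase rs fr).
  by rewrite /phases_done !set_cell_neq.
set t := run f s; move=> [[kn kq gs cnt] upd leg best low].
have Z p : p < n -> t xGoal p = 0.
  by case: cnt => [|h]; [rewrite -/k; lia|exact: h].
split=> //.
move=> v vn; exists (t xBest v); first by case: (best v vn) => ?; [left|right].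
move=> R N ans; case: (low v R N vn ans) => // RX.
have RF p : p < n -> R p -> False by move=> pn Rp; have := RX p pn Rp; rewrite Z.
have [wfg _ _ _ _] := rs.
(* With [R] empty, no targets and infinite distances form a solution, for which [answered] absurdly
   demands a finite start distance. *)
have triv : solution (game_of s) (fun=> 0) (fun=> 0) (fun=> 0) (fun=> 0).
  move=> p pn; rewrite /bellman; case: ifP => _; split=> //.
  by have [e ie] := wfg.2 p pn; exists e.
by have [] := ans.2 _ _ _ _ triv (fun p pn Rp => False_ind _ (RF p pn Rp)).
Qed.

(** * Tables built by the prelude *)

Lemma run_offsets s (t := run offsets s) : s xNum 0 = 0 ->
  t xNum 0 = s aSize 2 * s aSize 0 /\
  forall q, q < s aSize 2 -> t xOff q = q * s aSize 0.
Proof.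
move=> n0; apply: (@run_for (fun k t => t xNum 0 = k * s aSize 0 /\
  forall q, q < k -> t xOff q = q * s aSize 0)); first by [].
move=> k u _ uk fr [h1 h2]; rewrite /= /set_cell /= uk h1 (fr aSize) //.
split; first by rewrite mulSn addnC.
move=> q; rewrite ltnS leq_eqVlt; case: (q =P k) => [->|_] //=; exact: h2.
Qed.

Lemma put_same s a e1 e2 j :
  run (Put a e1 e2) s a j = if j == eval s e1 then eval s e2 else s a j.
Proof. by rewrite /= /set_cell eqxx. Qed.

(** Successors are stored by current state and new vertex: a move to [u] from any position of row
    [q] looks up [xSucc] at [xOff q + u]. *)
Definition entry (s t : store) base q v : Prop :=
  let p := s xOff q + v in let r := s aStep (base + s aColor v) in
  [/\ t xVert p = v, t xRow p = s xOff q, t xState p = r,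
      t xSucc p = s xOff r + v & t xGoal p = s aAcc q].

Lemma run_table_row s (q := s iState 0) (b := s xStepBase 0)
    (t := run table_row s) :
  [/\ forall v, v < s aSize 0 -> entry s t b q v,
      forall a p, a \in [:: xVert; xRow; xState; xSucc; xGoal] -> p < s xOff q ->
        t a p = s a p
    & t xPhases 0 = s xPhases 0 + s aSize 0 * s aAcc q].
Proof.
apply: (@run_for (fun k t =>
  [/\ forall v, v < k -> entry s t b q v,
      forall a p, a \in [:: xVert; xRow; xState; xSucc; xGoal] -> p < s xOff q ->
        t a p = s a p
    & t xPhases 0 = s xPhases 0 + k * s aAcc q])).
  by split; rewrite ?set_cell_neq ?addn0 // => a p am _; rewrite set_cell_neq
    //; apply: contraTneq am => ->.
move=> k u _ uk fr [h1 h2 h3]; set w := run _ u.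
set p := s xOff q + k; have ub b' : b' \in [:: aSize; aColor; aStep; aAcc;
  xOff; iState; xStepBase] -> u b' = s b'.
  by move=> bm; apply: fr; move: b' bm; apply/allP.
have ubs := (ub aColor isT, ub aStep isT, ub aAcc isT, ub xOff isT, ub iState
  isT, ub xStepBase isT).
rewrite /w !run_then.
set w1 := run (Put xPos _ _) u; set w2 := run (Put xVert _ _) w1.
set w3 := run (Put xRow _ _) w2; set w4 := run (Put xState _ _) w3.
set w5 := run (Put xSucc _ _) w4; set w6 := run (Put xGoal _ _) w5.
set w7 := run _ w6.
have f1 b' : b' != xPos -> w1 b' = u b' by exact: set_cell_neq.
have f2 b' : b' != xVert -> w2 b' = w1 b' by exact: set_cell_neq.
have f3 b' : b' != xRow -> w3 b' = w2 b' by exact: set_cell_neq.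
have f4 b' : b' != xState -> w4 b' = w3 b' by exact: set_cell_neq.
have f5 b' : b' != xSucc -> w5 b' = w4 b' by exact: set_cell_neq.
have f6 b' : b' != xGoal -> w6 b' = w5 b' by exact: set_cell_neq.
have f7 b' : b' != xPhases -> w7 b' = w6 b' by exact: set_cell_neq.
have p1 : w1 xPos 0 = p by rewrite /w1 put_same /= uk !ubs.
have c2 j : w7 xVert j = if j == p then k else u xVert j.
  by rewrite f7 // f6 // f5 // f4 // f3 // /w2 put_same /= p1 !f1 // uk.
have c3 j : w7 xRow j = if j == p then s xOff q else u xRow j.
  rewrite f7 // f6 // f5 // f4 // /w3 put_same /= (f2 xPos) // p1 (f2 xRow) //
    (f1 xRow) //.
  by rewrite (f2 xOff) // (f1 xOff) // (f2 iState) // (f1 iState) // !ubs.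
pose r := s aStep (b + s aColor k).
have c4' j : w4 xState j = if j == p then r else u xState j.
  rewrite /w4 put_same /= (f3 xPos) // (f2 xPos) // p1 (f3 xState) // (f2
    xState) // (f1 xState) //.
  rewrite (f3 aStep) // (f2 aStep) // (f1 aStep) // (f3 xStepBase) // (f2
    xStepBase) // (f1 xStepBase) //.
  by rewrite (f3 aColor) // (f2 aColor) // (f1 aColor) // (f3 iVert) // (f2
    iVert) // (f1 iVert) // uk !ubs.
have c4 j : w7 xState j = if j == p then r else u xState j.
  by rewrite f7 // f6 // f5.
have c5 j : w7 xSucc j = if j == p then s xOff r + k else u xSucc j.
  rewrite f7 // f6 // /w5 put_same /= (f4 xPos) // (f3 xPos) // (f2 xPos) // p1
    c4' eqxx.
  rewrite (f4 xSucc) // (f3 xSucc) // (f2 xSucc) // (f1 xSucc) //.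
  rewrite (f4 xOff) // (f3 xOff) // (f2 xOff) // (f1 xOff) //.
  by rewrite (f4 iVert) // (f3 iVert) // (f2 iVert) // (f1 iVert) // uk !ubs.
have c6 j : w7 xGoal j = if j == p then s aAcc q else u xGoal j.
  rewrite f7 // /w6 put_same /= (f5 xPos) // (f4 xPos) // (f3 xPos) // (f2
    xPos) // p1.
  rewrite (f5 xGoal) // (f4 xGoal) // (f3 xGoal) // (f2 xGoal) // (f1 xGoal) //.
  rewrite (f5 aAcc) // (f4 aAcc) // (f3 aAcc) // (f2 aAcc) // (f1 aAcc) //.
  by rewrite (f5 iState) // (f4 iState) // (f3 iState) // (f2 iState) // (f1
    iState) // !ubs.
have c7 : w7 xPhases 0 = u xPhases 0 + s aAcc q.
  rewrite /w7 put_same /= (f6 xPhases) // (f5 xPhases) // (f4 xPhases) // (f3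
    xPhases) // (f2 xPhases) // (f1 xPhases) //.
  rewrite (f6 aAcc) // (f5 aAcc) // (f4 aAcc) // (f3 aAcc) // (f2 aAcc) // (f1
    aAcc) //.
  by rewrite (f6 iState) // (f5 iState) // (f4 iState) // (f3 iState) // (f2
    iState) // (f1 iState) // !ubs.
have wk : entry s w7 b q k by rewrite /entry c2 c3 c4 c5 c6 eqxx.
have wo a j : a \in [:: xVert; xRow; xState; xSucc; xGoal] -> j != p -> w7 a j
  = u a j.
  move=> am /negPf jp; move: am; rewrite !inE.
  by do ![case/orP=> [/eqP->|]]; [|..|move/eqP->]; rewrite ?(c2, c3, c4, c5, c6) jp.
clearbody w7.
split.
- move=> v; rewrite ltnS leq_eqVlt => /orP[/eqP->|vk].
    by move: wk; rewrite /entry !set_cell_neq.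
  have pk : s xOff q + v != s xOff q + k by rewrite eqn_add2l; lia.
  by move: (h1 v vk); rewrite /entry !set_cell_neq // !wo.
- move=> a j am jk; rewrite set_cell_neq; last by apply: contraTneq am => ->.
  by rewrite wo ?h2 // /p; lia.
- by rewrite set_cell_neq // c7 h3 mulSn; lia.
Qed.

Lemma run_tables s (t := run tables s) (nv := s aSize 0) :
  s xStepBase 0 = 0 -> (forall q, q < s aSize 2 -> s xOff q = q * nv) ->
  (forall q v, q < s aSize 2 -> v < nv -> entry s t (q * s aSize 3) q v) /\
  t xPhases 0 = s xPhases 0 + nv * \sum_(q < s aSize 2) s aAcc q.
Proof.
move=> b0 off.
suff : [/\ forall q v, q < s aSize 2 -> v < nv -> entry s t (q * s aSize 3) q v,
    t xStepBase 0 = s aSize 2 * s aSize 3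
  & t xPhases 0 = s xPhases 0 + nv * \sum_(q < s aSize 2) s aAcc q] by case.
apply: (@run_for (fun k t =>
  [/\ forall q v, q < k -> v < nv -> entry s t (q * s aSize 3) q v,
      t xStepBase 0 = k * s aSize 3
    & t xPhases 0 = s xPhases 0 + nv * \sum_(q < k) s aAcc q])).
  by split=> //; rewrite set_cell_neq // big_ord0 muln0 addn0.
move=> k u kn uk fr [h1 h2 h3]; rewrite run_then.
have := run_table_row u; have fw b : b \notin writes table_row -> run table_row
  u b = u b by exact: run_frame.
move: (run table_row u) fw => w fw.
rewrite uk h2 (fr aSize) // (fr aAcc) // (fr xOff) // h3 => -[w1 w2 w3].
rewrite !set_cell_neq //; set x := run _ w.
have xw b : b != xStepBase -> x b = w b by move=> bx; rewrite /x /= set_cell_neq.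
split; first last.
- by rewrite xw // w3 big_ord_recr /=; lia.
- by rewrite /x /= /set_cell /= fw // (fw aSize) // h2 (fr aSize) // mulSn addnC.
move=> q v; rewrite ltnS leq_eqVlt => /orP[/eqP->|qk] vn.
  move: (w1 v vn); rewrite /entry !set_cell_neq // !xw //.
  by rewrite (fr xOff) // (fr aStep) // (fr aColor) // (fr aAcc).
move: (h1 q v qk vn); rewrite /entry !set_cell_neq // !xw //.
(* Row [k] is written from [xOff k] on, above all earlier rows. *)
have lt : s xOff q + v < s xOff k by rewrite !off //; [nia|lia].
by rewrite !w2.
Qed.

Lemma run_some_moves s (t := run some_moves s) e : e < s aSize 1 ->
  exists2 e', e' < s aSize 1 &
    s aSrc e' = s aSrc e /\ t xMove (s aSrc e) = s aTgt e'.
Proof.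
suff : forall e, e < s aSize 1 -> exists2 e', e' < s aSize 1 &
    s aSrc e' = s aSrc e /\ t xMove (s aSrc e) = s aTgt e' by apply.
apply: (@run_for (fun k t => forall e, e < k -> exists2 e', e' < k &
    s aSrc e' = s aSrc e /\ t xMove (s aSrc e) = s aTgt e')); first by [].
move=> k u _ uk fr h {}e; rewrite /= /set_cell /= uk (fr aSrc) // (fr aTgt) //.
case: (s aSrc e =P s aSrc k) => [->|ne]; first by exists k.
rewrite ltnS leq_eqVlt => /orP[/eqP ek|/h [e' ? ?]]; first by rewrite ek in ne.
by exists e' => //; exact: ltnW.
Qed.

Lemma run_prelude s (t := run prelude s) (nv := s aSize 0) (nq := s aSize 2) :
  (forall a i, 8 <= a -> s a i = 0) ->
  (forall q v, q < nq -> v < nv -> s aStep (q * s aSize 3 + s aColor v) < nq) ->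
  [/\ t xNum 0 = nq * nv,
      forall q, q < nq -> t xOff q = q * nv,
      forall q v, q < nq -> v < nv -> entry t t (q * s aSize 3) q v,
      t xPhases 0 = (nv * \sum_(q < nq) s aAcc q).+1
    & forall e, e < s aSize 1 -> exists2 e', e' < s aSize 1 &
        s aSrc e' = s aSrc e /\ t xMove (s aSrc e) = s aTgt e'].
Proof.
move=> z stepn; rewrite {}/t.
rewrite (_ : run prelude s = run some_moves (run tables
  (run (Put xPhases (Lit 0) (Lit 1)) (run offsets s)))) //.
have := run_offsets (z xNum 0 isT).
have f1 b : b \notin writes offsets -> run offsets s b = s b by exact: run_frame.
move: (run offsets s) f1 => t1 f1 [n1 o1].
set t2 := run (Put _ _ _) t1.
have f2 b : b != xPhases -> t2 b = t1 b by move=> bx; rewrite /t2 /= set_cell_neq.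
have := @run_tables t2; have f3 b : b \notin writes tables -> run tables t2 b =
  t2 b by exact: run_frame.
move: (run tables t2) f3 => t3 f3.
have f30 b : b \notin xPhases :: writes offsets ++ writes tables -> t3 b = s b.
  move=> h; rewrite f3 ?f2 ?f1 //; try exact: sub_notin h.
  by move: h; rewrite in_cons negb_or => /andP[].
rewrite (f2 xStepBase) // (f1 xStepBase) // (f2 xOff) // (f2 aSize) // (f1
  aSize) //.
rewrite -/nv -/nq (f2 aAcc) // (f1 aAcc) // => /(_ (z xStepBase 0 isT) o1) [en ph].
have f4 b : b != xMove -> b != iEdge -> run some_moves t3 b = t3 b.
  by move=> b1 b2; apply: run_frame; rewrite !inE negb_or b1 b2.
have := @run_some_moves t3.
move: (run some_moves t3) f4 => t4 f4.
rewrite (f30 aSize) // (f30 aSrc) // (f30 aTgt) // => mv.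
split=> //.
- by rewrite f4 // f3 // f2.
- by move=> q qn; rewrite f4 // f3 // f2 // o1.
- move=> q v qn vn; have := en q v qn vn.
  by rewrite /entry !(f4 _) // (f3 xOff) // (f3 aStep) // (f3 aColor) // (f3 aAcc).
- by rewrite f4 // ph.
Qed.

(** * Values of strategies *)

Lemma lee_emin (S : set nat) n :
  lee (emin S) (Some n) <-> exists2 m, S m & m <= n.
Proof.
rewrite /emin; case: pselect => [ex|nex] /=.
  case: ex_minnP => m /asboolP Sm mn; split; first by exists m.
  by move=> [k Sk kn]; apply: leq_trans kn; apply: mn; apply/asboolP.
by split=> // -[m Sm _]; case: nex; exists m; apply/asboolP.
Qed.

Lemma lee_esup (S : set enat) n :
  lee (esup S) (Some n) <-> forall x, S x -> lee x (Some n).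
Proof.
rewrite /esup; split=> [/lee_emin [m ub mn] x /ub|ub]; last first.
  by apply/lee_emin; exists n.
by case: x => //= x xm; exact: leq_trans mn.
Qed.

Lemma lee_play_value C (A : arena C) (K : set (seq C)) (rho : play A) n :
  lee (play_value K rho) (Some n) <->
  forall j, exists j', [/\ j < j', K [seq color (rho i) | i <- iota 0 j'.+1]
                         & infix_weight rho j j' <= n].
Proof.
rewrite /play_value; split=> [/lee_esup h j|h].
  by have /lee_emin[_ [j' [jj' Kj'] <-] ?] := h _ (ex_intro2 _ _ j I erefl);
    exists j'.
apply/lee_esup => _ [j _ <-]; apply/lee_emin.
by have [j' [jj' Kj' le]] := h j; exists (infix_weight rho j j') => //; exists j'.
Qed.

Section Product.
Context (C : finType) (A : arena C) (D : dfa C).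

Definition next_state (q : state D) (v : A) : state D := step q (color v).

Definition state_at (rho : play A) j : state D :=
  foldl next_state (initial D) [seq rho i | i <- iota 0 j.+1].

Lemma state_at0 rho : state_at rho 0 = next_state (initial D) (rho 0).
Proof. by []. Qed.

Lemma state_atS rho j : state_at rho j.+1 = next_state (state_at rho j) (rho j.+1).
Proof.
by rewrite /state_at -addn1 iotaD map_cat foldl_cat /= add0n.
Qed.

Lemma eq_state_at rho rho' j : (forall i, i <= j -> rho i = rho' i) ->
  state_at rho j = state_at rho' j.
Proof.
elim: j => [|j IH] e; first by rewrite !state_at0 e.
by rewrite !state_atS e // IH // => i ij; apply: e; exact: leqW.
Qed.

Lemma language_at rho j :
  language D [seq color (rho i) | i <- iota 0 j.+1] <->
  state_at rho j \in accepting D.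
Proof.
rewrite /language /state_at /mkset.
rewrite (_ : foldl _ _ _ = foldl next_state (initial D) [seq rho i | i <- iota
  0 j.+1]) //.
by elim: (iota 0 j.+1) (initial D) => //= i s IH q; rewrite IH.
Qed.

Lemma infix_weight_recl (rho : play A) j j' : j < j' ->
  infix_weight rho j j' = weight (rho j, rho j.+1) + infix_weight rho j.+1 j'.
Proof. by move=> jj'; rewrite /infix_weight big_ltn. Qed.

Lemma infix_weight_recr (rho : play A) j j' : j <= j' ->
  infix_weight rho j j'.+1 = infix_weight rho j j' + weight (rho j', rho j'.+1).
Proof. by move=> jj'; rewrite /infix_weight big_nat_recr. Qed.

(** Until [X] is visited, each move lowers [d] by at least its weight and strictly lowers [rank]. So
    [X] is visited after finitely many moves, with weight below [d]; there [d] is again at most [b].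
    Codes exceed distances by one, whence [b.-1]. *)
Lemma play_value_le (X : state D -> A -> bool) (d rank : state D -> A -> nat)
    (choice : state D -> A -> A) b (rho : play A) :
  (forall q v, X q v -> q \in accepting D /\ 0 < d q v <= b) ->
  (forall q v u, 0 < d q v -> (v, u) \in edges A ->
     (v \in owned0 A -> u = choice q v) ->
     if X (next_state q u) u then weight (v, u) < d q v
     else [&& 0 < d (next_state q u) u,
              weight (v, u) + d (next_state q u) u <= d q v
            & rank (next_state q u) u < rank q v]) ->
  is_play rho ->
  (forall j, rho j \in owned0 A -> rho j.+1 = choice (state_at rho j) (rho j)) ->
  0 < d (state_at rho 0) (rho 0) <= b ->
  lee (play_value (language D) rho) (Some b.-1).
Proof.
move=> XP dP rhoP rho0 d0.
have dpos j : 0 < d (state_at rho j) (rho j) <= b.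
  elim: j => // j /andP[IH1 IH2].
  have := dP _ _ _ IH1 (rhoP j) (rho0 j); rewrite -state_atS.
  by case: ifP => [/XP[]|_ /and3P[]] //; lia.
apply/lee_play_value => j.
suff [j' [jj' acc le]] : exists j', [/\ j < j', state_at rho j' \in accepting D
    & infix_weight rho j j' < d (state_at rho j) (rho j)].
  by exists j'; split=> //; [exact/language_at|have := dpos j; lia].
move: {2}(rank _ _).+1 (ltnSn (rank (state_at rho j) (rho j))) => m.
elim: m j => // m IH j rm; have /andP[dj _] := dpos j.
have := dP _ _ _ dj (rhoP j) (rho0 j); rewrite -state_atS; case: ifP =>
  [/XP[acc _] w|_ /and3P[d1 w r1]].
  by exists j.+1; split=> //; rewrite infix_weight_recl // /infix_weight
    big_geq // addn0.
have [|j' [jj' acc le]] := IH j.+1; first exact: leq_trans r1 _.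
exists j'; split=> //; first exact: ltnW.
by rewrite infix_weight_recl; lia.
Qed.

Section Against.
Context (sigma : strategy A) (adv : state D -> A -> A).

(* The play that follows [rho] up to position [j0]; from there on Player 1
   plays [adv]. The tail is given, not the vertex, since [sigma] reads it. *)
Fixpoint deviation_tail (rho : play A) j0 j : seq A :=
  if j is i.+1 then
    let s := deviation_tail rho j0 i in
    rcons s (if i < j0 then rho i.+1
             else if last (rho 0) s \in owned0 A then sigma (rho 0) s
             else adv (foldl next_state (initial D) (rho 0 :: s)) (last (rho 0) s))
  else [::].

Definition deviation rho j0 : play A :=
  fun j => last (rho 0) (deviation_tail rho j0 j).

Lemma deviation_tailE rho j0 j :
  deviation_tail rho j0 j = [seq deviation rho j0 i | i <- iota 1 j].
Proof.
elim: j => // j IH.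
rewrite -[in RHS](addn1 j) iotaD map_cat -IH /= add1n cats1; congr rcons.
by rewrite /deviation /= last_rcons.
Qed.

Lemma deviationS rho j0 j :
  deviation rho j0 j.+1 =
  if j < j0 then rho j.+1
  else if deviation rho j0 j \in owned0 A then
    sigma (deviation rho j0 0) [seq deviation rho j0 i | i <- iota 1 j]
  else adv (state_at (deviation rho j0) j) (deviation rho j0 j).
Proof. by rewrite {1}/deviation /= last_rcons -deviation_tailE /state_at /=
  -deviation_tailE. Qed.

Lemma deviation_prefix rho j0 j : j <= j0 -> deviation rho j0 j = rho j.
Proof. by case: j => // j jj0; rewrite deviationS jj0. Qed.

Lemma deviation_consistent (rho : play A) j0 :
  (forall j, j < j0 -> rho j \in owned0 A ->
     rho j.+1 = sigma (rho 0) [seq rho i | i <- iota 1 j]) ->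
  consistent sigma (deviation rho j0).
Proof.
move=> con j; rewrite deviationS; case: ltnP => [jj0|_ ->] //.
rewrite deviation_prefix ?(ltnW jj0) // deviation_prefix // => /(con j jj0) ->.
congr (sigma _ _); apply/eq_in_map => i; rewrite mem_iota => /andP[_ ij].
by rewrite deviation_prefix //; lia.
Qed.

Lemma deviation_is_play (rho : play A) j0 :
  (forall q v, v \notin owned0 A -> (v, adv q v) \in edges A) ->
  (forall j, j < j0 -> (rho j, rho j.+1) \in edges A) ->
  is_play (deviation rho j0).
Proof.
move=> advE rhoP j; rewrite deviationS; case: ltnP => [jj0|_].
  by rewrite deviation_prefix ?(ltnW jj0) // rhoP.
case: ifP => own0; last by apply: advE; rewrite own0.
set s := [seq _ | i <- _].
have ls : last (deviation rho j0 0) s = deviation rho j0 j.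
  by rewrite /s -deviation_tailE.
by rewrite -{1}ls; apply: move_edge; rewrite ls.
Qed.

(** Along [adv], the weight since [j0] plus [d] never drops before a visit to [X]. If [d] exceeded
    [n.+1] at [j0], Player 1 could deviate there and delay [X], hence every accepting position,
    beyond weight [n]. *)
Lemma deviation_bound (X : state D -> A -> bool) (d : state D -> A -> nat)
    (rho : play A) j0 n :
  (forall q v, v \notin owned0 A -> (v, adv q v) \in edges A) ->
  (forall q v u, (v, u) \in edges A -> (v \in owned0 A \/ u = adv q v) ->
     if X (next_state q u) u then 0 < d q v <= (weight (v, u)).+1
     else (0 < d (next_state q u) u) ==>
       (0 < d q v <= weight (v, u) + d (next_state q u) u)) ->
  (forall j, j < j0 -> (rho j, rho j.+1) \in edges A) ->
  (forall j, j < j0 -> rho j \in owned0 A ->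
     rho j.+1 = sigma (rho 0) [seq rho i | i <- iota 1 j]) ->
  lee (strategy_value (language D) sigma (rho 0)) (Some n) ->
  (forall rho', is_play rho' -> rho' 0 = rho 0 -> consistent sigma rho' ->
     forall j, 0 < j -> state_at rho' j \in accepting D ->
     X (state_at rho' j) (rho' j)) ->
  0 < d (state_at rho j0) (rho j0) <= n.+1.
Proof.
move=> advE dP rhoP con /lee_esup val RX; set r := deviation rho j0.
have rP : is_play r by exact: deviation_is_play.
have rc : consistent sigma r by exact: deviation_consistent.
have r0 : r 0 = rho 0 by [].
have rj : r j0 = rho j0 by rewrite /r deviation_prefix.
have sj : state_at r j0 = state_at rho j0.
  by apply: eq_state_at => i ij; rewrite /r deviation_prefix.
rewrite -rj -sj; apply/negPn/negP => bad.
have /lee_play_value /(_ j0) [j' [jj' /language_at acc le]] :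
    lee (play_value (language D) r) (Some n).
  by apply: val; exists r.
(* The first alternative holds from the first visit to [X] on, the second before it; an infinite [d]
   satisfies the second vacuously. *)
have inv j : j0 <= j -> n < infix_weight r j0 j \/
    (0 < d (state_at r j) (r j) -> n.+1 < infix_weight r j0 j + d (state_at r
      j) (r j)).
  elim: j => [|j IH].
    by rewrite leqn0 => /eqP j00; right; rewrite -j00 /infix_weight big_geq //; lia.
  rewrite leq_eqVlt => /orP[/eqP <-|jj0].
    by right; rewrite /infix_weight big_geq //; lia.
  rewrite infix_weight_recr //; case: (IH jj0) => [h|h]; first by left; lia.
  have := dP (state_at r j) (r j) (r j.+1) (rP j).
  rewrite -state_atS.
  have alt : r j \in owned0 A \/ r j.+1 = adv (state_at r j) (r j).
    rewrite {2}/r deviationS ltnNge -ltnS jj0 /=.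
    by case: ifP => _; [left|right].
  by move=> /(_ alt); case: ifP => _ h1; [left|right]; lia.
case: j' => // j' in jj' acc le *.
have Xj : X (state_at r j'.+1) (r j'.+1) by exact: RX.
have := dP (state_at r j') (r j') (r j'.+1) (rP j').
rewrite -state_atS Xj => h.
have hd : 0 < d (state_at r j') (r j') <= (weight (r j', r j'.+1)).+1.
  apply: h; rewrite {2}/r deviationS ltnNge -ltnS jj' /=.
  by case: ifP => _; [left|right].
move: le; rewrite infix_weight_recr //.
by case: (inv j' jj') => h'; lia.
Qed.

End Against.
End Product.

(** * Correctness of the solver *)

Lemma code_lt (T : finType) (x : T) : code x < #|T|.
Proof. exact: ltn_ord. Qed.

Lemma code_inj (T : finType) : injective (@code T).
Proof. by move=> x y /ord_inj /enum_rank_inj. Qed.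

Lemma code_surj (T : finType) i : i < #|T| -> exists x : T, code x = i.
Proof. by move=> iT; exists (enum_val (Ordinal iT)); rewrite /code enum_valK. Qed.

Lemma code_ord n (i : 'I_n) : code i = i.
Proof. by rewrite /code enum_rank_ord. Qed.

Lemma sum_ord_mul (F : nat -> nat) m n :
  \sum_(p < m * n) F p = \sum_(i < m) \sum_(j < n) F (i * n + j).
Proof.
elim: m => [|m IH]; first by rewrite !big_ord0.
by rewrite mulSnr big_split_ord /= IH big_ord_recr.
Qed.

Lemma sum_enum_val_mem (T : finType) (S : {set T}) :
  \sum_(i < #|T|) (enum_val i \in S) = #|S|.
Proof.
rewrite -[LHS](big_enum_val (fun x : T => nat_of_bool (x \in S))) /=.
by rewrite -sum1_card big_mkcond [RHS]big_mkcond /=; apply: eq_bigr => x _;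
  case: (x \in S).
Qed.

Lemma lee_le x m n : lee x (Some m) -> m <= n -> lee x (Some n).
Proof. by case: x => //= k; exact: leq_trans. Qed.

Section Encoding.
Context (C : finType) (A : arena C) (D : dfa C) (s : store).
Hypothesis enc : encodes_input A D s.

Definition position (q : state D) (v : A) := code q * #|A| + code v.

Let s1 := run prelude s.
Let g := game_of s1.

Lemma size_edges : s aSize 1 = #|edges A|. Proof. by case: enc => -[]. Qed.

Lemma position_lt q v : position q v < #|state D| * #|A|.
Proof. by have := code_lt q; have := code_lt v; rewrite /position; nia. Qed.

Lemma position_surj p : p < #|state D| * #|A| -> exists q v, p = position q v.
Proof.
move=> pn; have A0 : 0 < #|A| by case: #|A| pn => //; rewrite muln0.
have [|q Hq] := @code_surj (state D) (p %/ #|A|); first by rewrite ltn_divLR.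
have [|v Hv] := @code_surj A (p %% #|A|); first by rewrite ltn_mod.
by exists q, v; rewrite /position Hq Hv -divn_eq.
Qed.

Lemma prelude_frame a : a < 8 -> s1 a = s a.
Proof.
by move=> a8; apply: run_frame; move: a a8; do 8!case=> //.
Qed.

Lemma step_table (q : state D) (v : A) :
  s aStep (code q * s aSize 3 + s aColor (code v)) = code (next_state q v).
Proof.
case: enc => -[_ _ _ -> _] hv _ hq _.
by have [_ ->] := hv v; have [-> _] := hq q.
Qed.

Lemma prelude_facts :
  [/\ s1 xNum 0 = #|state D| * #|A|,
      forall q, q < #|state D| -> s1 xOff q = q * #|A|,
      forall q v, q < #|state D| -> v < #|A| -> entry s1 s1 (q * s aSize 3) q v,
      s1 xPhases 0 = (#|A| * \sum_(q < #|state D|) s aAcc q).+1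
    & forall e, e < #|edges A| -> exists2 e', e' < #|edges A| &
        s aSrc e' = s aSrc e /\ s1 xMove (s aSrc e) = s aTgt e'].
Proof.
have := @run_prelude s; case: (enc) => -[-> -> -> _ _] _ _ _ z /(_ z); apply.
move=> q v /code_surj[q' <-] /code_surj[v' <-].
by rewrite step_table code_lt.
Qed.

Lemma prelude_num : s1 xNum 0 = #|state D| * #|A|.
Proof. by case: prelude_facts. Qed.

Lemma prelude_off (q : state D) : s1 xOff (code q) = code q * #|A|.
Proof. by case: prelude_facts => _ h _ _ _; rewrite h ?code_lt. Qed.

Lemma prelude_entry q v :
  [/\ s1 xVert (position q v) = code v, s1 xRow (position q v) = code q * #|A|,
      s1 xState (position q v) = code (next_state q v),
      s1 xSucc (position q v) = position (next_state q v) v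
    & s1 xGoal (position q v) = (q \in accepting D)].
Proof.
have [_ _ h _ _] := prelude_facts.
have := h _ _ (code_lt q) (code_lt v); rewrite /entry prelude_off.
rewrite !(@prelude_frame aStep) // !(@prelude_frame aColor) // step_table
  prelude_off.
rewrite (@prelude_frame aAcc) // => -[-> -> -> -> ->]; split=> //.
by case: enc => _ _ _ hq _; case: (hq q).
Qed.

Lemma prelude_phases : s1 xPhases 0 = (#|A| * #|accepting D|).+1.
Proof.
have [_ _ _ -> _] := prelude_facts; congr (_ * _).+1.
rewrite -sum_enum_val_mem; apply: eq_bigr => i _.
case: enc => _ _ _ hq _; have [_] := hq (enum_val i).
by rewrite /code enum_valK.
Qed.

Lemma initial_code : s1 aSize 4 = code (initial D).
Proof. by rewrite prelude_frame //; case: enc => -[]. Qed.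

Lemma start_position (v : A) :
  start s1 (code v) = position (next_state (initial D) v) v.
Proof.
rewrite /start initial_code prelude_off.
by have [_ _ _ -> _] := prelude_entry (initial D) v.
Qed.

Lemma start_stateE (v : A) :
  start_state s1 (code v) = code (next_state (initial D) v).
Proof.
rewrite /start_state initial_code prelude_off.
by have [_ _ -> _ _] := prelude_entry (initial D) v.
Qed.

Lemma own_position q v : own g (position q v) = (v \in owned0 A).
Proof.
rewrite /g /=; have [-> _ _ _ _] := prelude_entry q v.
rewrite (@prelude_frame aOwner) //; case: enc => _ hv _ _ _.
by have [-> _] := hv v; case: (v \in _).
Qed.

Lemma tau_position q v e u : s aTgt e = code u ->
  tau g (position q v) e = position (next_state q u) u.
Proof.
move=> eu; rewrite /g /=; have [_ -> _ _ _] := prelude_entry q v.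
rewrite (@prelude_frame aTgt) // eu.
by have [_ _ _ -> _] := prelude_entry q u.
Qed.

Lemma edge_inc q v u : (v, u) \in edges A ->
  exists e, [/\ inc g (position q v) e, tgt g e = code u,
    tau g (position q v) e = position (next_state q u) u & wt g e = weight (v, u)].
Proof.
move=> vu; pose i := enum_rank_in vu (v, u).
have iE : enum_val i = (v, u) by exact: enum_rankK_in.
have [s3 s4 s5] : [/\ s aSrc i = code v, s aTgt i = code u & s aWt i = weight
  (v, u)].
  by case: enc => _ _ h _ _; have := h i; rewrite iE.
exists i; split; [| |exact: tau_position|]; rewrite /g /= prelude_frame //.
rewrite size_edges ltn_ord (@prelude_frame aSrc) // s3 /=.
by have [-> _ _ _ _] := prelude_entry q v.
Qed.

Lemma inc_edge q v e : inc g (position q v) e ->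
  exists u, [/\ (v, u) \in edges A, tgt g e = code u,
    tau g (position q v) e = position (next_state q u) u & wt g e = weight (v, u)].
Proof.
rewrite {1}/g /= prelude_frame // size_edges (@prelude_frame aSrc) //.
have [-> _ _ _ _] := prelude_entry q v => /andP[lt /eqP sv].
pose i := Ordinal lt; have iE := enum_valP i.
have [] : [/\ s aSrc i = code (enum_val i).1, s aTgt i = code (enum_val i).2
    & s aWt i = weight (enum_val i)] by case: enc => _ _ h _ _; exact: h.
case: (enum_val i) iE => v' u ed; rewrite /= sv => /code_inj -> s4 s5.
by exists u; split; [|rewrite /g /= prelude_frame|exact: tau_position|rewrite
  /g /= prelude_frame].
Qed.

Lemma prelude_ready : ready s1.
Proof.
rewrite /ready -/g prelude_num (@prelude_frame aSize) // prelude_phases.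
have sA : s aSize 0 = #|A| by case: enc => -[].
split.
- have nvE : nv g = #|state D| * #|A| by rewrite /g /= prelude_num.
  split=> p; rewrite nvE.
    move=> e /position_surj[q [v ->]] /inc_edge[u [_ _ -> _]]; exact: position_lt.
  move=> /position_surj[q [v ->]]; have [u vu] := edges_total v.
  by have [e [ie _ _ _]] := edge_inc q vu; exists e.
- move=> p /position_surj[q [v ->]]; have [u vu] := edges_total v.
  have [e [ie _ _ _]] := edge_inc q vu.
  have [_ _ _ _ h] := prelude_facts.
  have [vE _ _ _ _] := prelude_entry q v.
  move: ie; rewrite {1}/g /= prelude_frame // size_edges (@prelude_frame aSrc)
    // vE.
  move=> /andP[/h[e' e'n [sE mE]] /eqP sv]; exists e'.
    by rewrite e'n sE sv /=.
  by rewrite (@prelude_frame aTgt) // -mE sv.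
- move=> v; rewrite sA => /code_surj[v' <-]; rewrite start_position; exact:
  position_lt.
- rewrite ltnS (sum_ord_mul (fun p => nat_of_bool (s1 xGoal p != 0))).
  have accE (q : 'I_#|state D|) (v : 'I_#|A|) : s1 xGoal (q * #|A| + v) =
    (enum_val q \in accepting D).
    have [_ _ _ _ <-] := prelude_entry (enum_val q) (enum_val v).
    by rewrite /position /code !enum_valK.
  rewrite -sum_enum_val_mem big_distrr /= leq_sum // => q _.
  have -> : #|A| * (enum_val q \in accepting D) = \sum_(v < #|A|) (enum_val q
    \in accepting D).
    by rewrite sum_nat_const card_ord.
  rewrite leq_sum // => v _.
  by rewrite accE; case: (_ \in _).
- have fr a : 7 < a -> a \notin writes prelude -> forall i, s1 a i = 0.
    by move=> a8 aw i; rewrite /s1 run_frame //; case: enc => _ _ _ _; apply.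
  by split; [exact: fr|exact: fr|move=> v; exact: fr|move=> v; exact: fr].
Qed.

(** For Player 1, [adv] takes an edge that attains the maximum in the given solution, and
    [deviation_bound] applies. Positions at time 0 are left out because an answer comes strictly
    after its request. *)
Lemma answered_below (sigma : strategy A) v n :
  lee (strategy_value (language D) sigma v) (Some n) ->
  answered s1 (code v) (fun p => exists (rho : play A) j,
    [/\ is_play rho, rho 0 = v, consistent sigma rho, 0 < j /\
        state_at D rho j \in accepting D & p = position (state_at D rho j) (rho
          j)]) n.
Proof.
move=> val; split.
  move=> p _ [rho [j [_ _ _ [_ acc] ->]]].
  by have [_ _ _ _ ->] := prelude_entry (state_at D rho j) (rho j); rewrite acc.
move=> X d rank ch sol RX.
have lt q w : position q w < nv g by rewrite /g /= prelude_num position_lt.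
pose d' (q : state D) w := d (position q w); pose X' (q : state D) w := X
  (position q w) != 0.
have via_lec q w u e : tau g (position q w) e = position (next_state q u) u ->
  wt g e = weight (w, u) -> lec (d (position q w)) (via g X d (position q w) e) ->
  if X' (next_state q u) u then 0 < d' q w <= (weight (w, u)).+1
     else (0 < d' (next_state q u) u) ==>
       (0 < d' q w <= weight (w, u) + d' (next_state q u) u).
  rewrite /via /level /X' /d' => -> ->.
  by case: (X _ != 0) => /=; rewrite /lec; [|case: (d (position _ u) =P 0) =>
    [->|] /=]; lia.
have [adv advP] : exists adv : state D -> A -> A, forall q w, w \notin owned0 A ->
    (w, adv q w) \in edges A /\
    if X' (next_state q (adv q w)) (adv q w) then 0 < d' q w <= (weight (w, adv
      q w)).+1
     else (0 < d' (next_state q (adv q w)) (adv q w)) ==>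
       (0 < d' q w <= weight (w, adv q w) + d' (next_state q (adv q w)) (adv q w)).
  suff /choice [f fP] : forall qw : state D * A, exists u, qw.2 \notin owned0 A ->
    (qw.2, u) \in edges A /\
    if X' (next_state qw.1 u) u then 0 < d' qw.1 qw.2 <= (weight (qw.2, u)).+1
     else (0 < d' (next_state qw.1 u) u) ==>
       (0 < d' qw.1 qw.2 <= weight (qw.2, u) + d' (next_state qw.1 u) u).
    by exists (fun q w => f (q, w)) => q w; apply: (fP (q, w)).
  move=> [q w] /=; have := sol _ (lt q w); rewrite /bellman own_position.
  case: ifP => [_ _|_ [_ [e ie le]]]; first by exists w.
  by have [u [ed _ tauE wE]] := inc_edge ie; exists u => _; split=> //; exact:
    via_lec le.
(* Only the moves before [j] must be legal and consistent: the empty prefix gives the start,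
   prefixes of plays give the elements of [R]. *)
have bound (rho : play A) j : rho 0 = v ->
    (forall i, i < j -> (rho i, rho i.+1) \in edges A) ->
    (forall i, i < j -> rho i \in owned0 A ->
       rho i.+1 = sigma (rho 0) [seq rho k | k <- iota 1 i]) ->
    lec (d (position (state_at D rho j) (rho j))) n.+1.
  move=> r0 rE rC; apply: (@deviation_bound _ _ _ sigma adv X' d' rho j n) => //.
  - by move=> q w /(advP q) [].
  - move=> q w u ed own; have [ow|ow] := boolP (w \in owned0 A).
      have [e [ie _ tauE wE]] := edge_inc q ed; apply: via_lec tauE wE _.
      by have := sol _ (lt q w); rewrite /bellman own_position ow => -[_]; exact.
    by case: own => [|->]; [rewrite (negPf ow)|have [] := advP q w ow].
  - by rewrite r0.
  - move=> rho' rP r0' rc k k0 acc; apply: RX; first exact: lt.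
    by exists rho', k; rewrite r0'.
split; first by rewrite start_position; apply: (bound (fun=> v) 0).
by move=> p _ [rho [j [rP r0 rc _ ->]]]; apply: bound => // i _; exact: rc.
Qed.

Let s2 := run main_loop s1.
Let phases := (#|A| * #|accepting D|).+1.
Let mem := 'I_(phases * #|state D|).

Lemma mem_split (m : mem) : exists i (q : state D),
  i < phases /\ m = i * #|state D| + code q :> nat.
Proof.
have nq : 0 < #|state D| by exact: leq_ltn_trans (code_lt (initial D)).
have [|q Hq] := @code_surj (state D) (m %% #|state D|); first by rewrite ltn_mod.
exists (m %/ #|state D|), q; split; last by rewrite Hq -divn_eq.
by rewrite ltn_divLR.
Qed.

Lemma mem_lt i (q : state D) : i < phases -> i * #|state D| + code q < phases *
  #|state D|.
Proof. by have := code_lt q; nia. Qed.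

(** The first vertex selects the phase through the initialization table, so a single strategy is
    optimal from all vertices. *)
Lemma main_loop_strategy (epsD : ~ language D [::]) :
  exists sigma : strategy A, encodes_strategy sigma s2 /\ @optimal C (Game A
    epsD) sigma.
Proof.
have [count upd leg init] := run_main_loop prelude_ready.
rewrite -/s2 prelude_num prelude_phases (@prelude_frame aSize) // -/phases in
  count upd leg init.
have [sV sQ] : s aSize 0 = #|A| /\ s aSize 2 = #|state D| by case: enc => -[].
rewrite sV sQ in count upd init.
have row i q (v : A) : (i * #|state D| + code q) * #|A| + code v
    = i * (#|state D| * #|A|) + position q v by rewrite /position; nia.
have updE i (q : state D) (v : A) : i < phases ->
    s2 oUpd ((i * #|state D| + code q) * #|A| + code v)
    = i * #|state D| + code (next_state q v).
  move=> ip; rewrite row upd ?position_lt //.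
  by have [_ _ -> _ _] := prelude_entry q v.
(* If no phase gave a finite bound, the entry is the default 0, a memory state since there are a
   phase and a DFA state. *)
have init_lt (v : A) : s2 oInit (code v) < phases * #|state D|.
  have [b [[_ ->]|[_ [i [ip -> _]]]] _] := init _ (code_lt v).
    by rewrite muln_gt0 /= (leq_ltn_trans _ (code_lt (initial D))).
  by rewrite start_stateE mem_lt.
have upd_lt (m : mem) (v : A) : s2 oUpd (m * #|A| + code v) < phases * #|state D|.
  by have [i [q [ip ->]]] := mem_split m; rewrite updE // mem_lt.
pose M := @Memory C A mem (fun v => Ordinal (init_lt v)) (fun m v => Ordinal
  (upd_lt m v)).
have nxt_ex : forall vm : A * mem, exists u, vm.1 \in owned0 A ->
    (vm.1, u) \in edges A /\ s2 oNext (vm.2 * #|A| + code vm.1) = code u.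
  move=> [v m] /=; have [i [q [ip ->]]] := mem_split m.
  have [ow|ow] := boolP (v \in owned0 A); last by exists v.
  have lt : position q v < nv g by rewrite /g /= prelude_num position_lt.
  have [|e ie E] := leg i ip _ lt; first by rewrite own_position.
  have [u [vu uE _ _]] := inc_edge ie; exists u => _; split=> //.
  by rewrite row E -uE.
have [nxt' nxtP] := choice nxt_ex; pose nxt v m := nxt' (v, m).
have nxtE v m : v \in owned0 A -> (v, nxt v m) \in edges A /\
    s2 oNext (m * #|A| + code v) = code (nxt v m) by exact: (nxtP (v, m)).
have mv x t : last x t \in owned0 A ->
    (last x t, nxt (last x t) (upd_star M x t)) \in edges A.
  by move=> ow; have [] := nxtE _ (upd_star M x t) ow.
exists (Strategy mv); split.
  exists M, nxt; split.
  - by split=> // v m ow; have [] := nxtE v m ow.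
  - by rewrite count card_ord.
  - by move=> v; rewrite code_ord.
  - by move=> m v; rewrite !code_ord.
  - by move=> m v ow; have [_] := nxtE v m ow; rewrite code_ord.
(* Nothing beats infinity trivially; a finite value [n] forces [b] to be finite, so that some phase
   [i] is selected. *)
move=> sigma' v /=; case val' : (strategy_value _ sigma' v) => [n|]; last by
  case: strategy_value.
have /answered_below ans : lee (strategy_value (language D) sigma' v) (Some n)
  by rewrite val' /=.
have [b alt /(_ _ _ ans) bn] := init _ (code_lt v).
have {alt bn} [bn b0 [i [ip iE [X [d [rank [sol XP dv]]]]]]] : [/\ b <= n.+1, b
  != 0 & exists i,
    [/\ i < phases, s2 oInit (code v) = i * #|state D| + start_state s1 (code v)
      & secured s1 (code v) (fun p => s2 oNext (i * (#|state D| * #|A|) + p)) b]].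
  case: alt => [[b0 _]|[b0 ex]]; first by move: bn; rewrite b0.
  by split=> //; move: bn; rewrite /lec; lia.
apply/lee_esup => _ [rho [rP r0 rc] <-].
(* Updates stay in phase [i] and track the DFA state. *)
have memE j : upd_star M (rho 0) [seq rho l | l <- iota 1 j]
    = i * #|state D| + code (state_at D rho j) :> nat.
  elim: j => [|j IH]; first by rewrite /= r0 iE start_stateE state_at0 r0.
  rewrite -(addn1 j) iotaD map_cat /upd_star foldl_cat /= -/(upd_star M _ _) IH.
  by rewrite updE // addn1 state_atS.
apply: (@lee_le _ b.-1); last by lia.
pose choice q v := nxt v (Ordinal (mem_lt q ip)).
apply: (@play_value_le C A D (fun q v => X (position q v) != 0)
  (fun q v => d (position q v)) (fun q v => rank (position q v)) choice) => //.
- move=> q w Xqw; have [] := XP (position q w) _ Xqw; first by rewrite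
  prelude_num position_lt.
  have [_ _ _ _ ->] := prelude_entry q w; rewrite /lec.
  by case: (q \in _) => // _ ?; split=> //; lia.
- move=> q w u /= dqw wu uE.
  have lt : position q w < nv g by rewrite /g /= prelude_num position_lt.
  have lvl e : tau g (position q w) e = position (next_state q u) u -> wt g e =
    weight (w, u) ->
      via g X d (position q w) e != 0 -> via g X d (position q w) e <= d
        (position q w) ->
      X (tau g (position q w) e) != 0 \/ rank (tau g (position q w) e) < rank
        (position q w) ->
      if X (position (next_state q u) u) != 0 then weight (w, u) < d (position q w)
      else [&& 0 < d (position (next_state q u) u),
              weight (w, u) + d (position (next_state q u) u) <= d (position q w)
            & rank (position (next_state q u) u) < rank (position q w)].
    rewrite /via /level => -> ->; case: (X _ != 0) => /=; first by lia.
    by case: (d (position _ u) =P 0) => //= d0 _ le [//|lt']; lia.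
  have := sol _ lt; rewrite -/g /bellman own_position; case: ifP => ow [h1 h2].
    have [|e ie [chE okE viaE]] := h1; first by lia.
    have [u' [wu' tE tauE wE]] := inc_edge ie.
    have uu' : u = u'.
      rewrite (uE ow); apply: code_inj; have [_ <-] := nxtE w (Ordinal (mem_lt
        q ip)) ow.
      by rewrite /= row chE tE.
    by subst u'; apply: lvl tauE wE _ _ okE; rewrite viaE //; lia.
  have [e [ie _ tauE wE]] := edge_inc q wu; have [le okE] := h1 e ie.
  by apply: lvl tauE wE _ _ _; [move: le dqw; rewrite /lec; lia..|apply: okE; lia].
- move=> j rj; rewrite (rc j rj) /=.
  have -> : last (rho 0) [seq rho l | l <- iota 1 j] = rho j.
    by case: j {rj} => // j; rewrite -(addn1 j) iotaD map_cat last_cat /= addnC.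
  by rewrite /choice; congr (nxt _ _); apply: val_inj; rewrite /= memE.
- by move: dv; rewrite start_position state_at0 r0 /lec; lia.
Qed.


End Encoding.

(** * Running time and conclusion *)

Definition solver : prog := Seq (compile prelude) (compile main_loop).

Lemma main_loop_rounds s : s aSize 0 <= s xNum 0 ->
  rounds s main_loop <=
  (s xPhases 0).+1 * ((s xNum 0).+1 * ((s xNum 0).+1 * (s aSize 1).+1)).
Proof.
rewrite /= !maxnn !muln1.
move: (s xPhases 0) (s xNum 0) (s aSize 0) (s aSize 1) => k n v e vn.
have maxn1 x : 0 < x -> maxn x 1 = x by move/maxn_idPl.
rewrite ![maxn 1 _]maxnC !maxn1 ?muln_gt0 ?leq_max //.
rewrite leq_mul2l /= !geq_max leq_pmulr ?muln_gt0 // leqnn /=.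
by apply: leq_trans (_ : n.+1 <= _) => //; rewrite leq_pmulr ?muln_gt0.
Qed.

(** Phases, rounds, positions and edges multiply to about [v * f], [q * v], [q * v] and [e]. The
    solver takes some steps even on empty data, so the factors are kept positive by [maxn 1]. *)
Lemma solver_time C (A : arena C) (D : dfa C) s : encodes_input A D s ->
  exec_within solver s
    ((8 * overhead prelude + 24 * overhead main_loop) *
     (maxn 1 #|A| ^ 3 * maxn 1 #|edges A| * #|state D| ^ 2
      * maxn 1 #|accepting D| ^ 2))
    (run main_loop (run prelude s)).
Proof.
move=> enc; have [/andP[c1 b1] /andP[c2 b2]] := (prelude_ok, main_loop_ok).
have [t1 E1 le1] := exec_compile s c1 b1.
have [t2 E2 le2] := exec_compile (run prelude s) c2 b2.
exists (t1 + t2); first exact: ExecSeq E1 E2.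
apply: leq_trans (leq_add le1 le2) _.
have nq : 0 < #|state D| by exact: leq_ltn_trans (code_lt (initial D)).
set v := maxn 1 #|A|; set e := maxn 1 #|edges A|; set f := maxn 1 #|accepting D|.
set q := #|state D| in nq *.
have [v0 e0 f0] : [/\ 0 < v, 0 < e & 0 < f] by rewrite !leq_max.
have [vA eA fA] : [/\ #|A| <= v, #|edges A| <= e & #|accepting D| <= f].
  by rewrite !leq_max !leqnn !orbT.
set B := v ^ 3 * e * q ^ 2 * f ^ 2.
have r1 : rounds s prelude <= 8 * B.
  have : rounds s prelude <= q.+1 * (#|A|.+1 * #|edges A|.+1).
    case: enc => -[sA sE sQ _ _] _ _ _ _; rewrite /= sA sE sQ !geq_max !maxnn -/q.
    move: #|A| #|edges A| => a b; rewrite !muln1 (maxn_idPl _) // muln_gt0 /=.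
    apply/and3P; split; first exact: leq_pmulr.
      by rewrite leq_mul2l leq_pmulr.
    by rewrite mulnA leq_pmull.
  move=> /leq_trans; apply.
  apply: leq_trans (_ : 2 * q * (2 * v * (2 * e)) <= _).
    by rewrite !leq_mul //; lia.
  have -> : 2 * q * (2 * v * (2 * e)) = 8 * (v * e * q) by lia.
  rewrite leq_mul2l /= /B -[v * e * q]muln1 !leq_mul ?expn_gt0 ?f0 //.
    by rewrite -{1}[v]expn1 leq_pexp2l.
  by rewrite -{1}[q]expn1 leq_pexp2l.
have r2 : rounds (run prelude s) main_loop <= 24 * B.
  have : rounds (run prelude s) main_loop <=
      (#|A| * #|accepting D|).+2 * ((q * #|A|).+1 * ((q * #|A|).+1 * #|edges
        A|.+1)).
    have sA : run prelude s aSize 0 = #|A| by rewrite prelude_frame //; case: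
      enc => -[].
    have sE : run prelude s aSize 1 = #|edges A| by rewrite prelude_frame //;
      case: enc => -[].
    have := @main_loop_rounds (run prelude s).
    rewrite (prelude_phases enc) (prelude_num enc) sA sE -/q; apply.
    exact: leq_pmull.
  move=> /leq_trans; apply.
  (* For positive [x], [x + 2 <= 3 * x] and [x + 1 <= 2 * x], whence the constant 24. A single
     factor [f] arises and is then weakened to its square. *)
  apply: leq_trans (_ : 3 * (v * f) * (2 * (q * v) * (2 * (q * v) * (2 * e))) <= _).
    have vf : #|A| * #|accepting D| <= v * f by exact: leq_mul.
    have qv : q * #|A| <= q * v by rewrite leq_mul2l vA orbT.
    have vf0 : 0 < v * f by rewrite muln_gt0 v0.
    have qv0 : 0 < q * v by rewrite muln_gt0 nq.
    by rewrite !leq_mul //; lia.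
  have -> : 3 * (v * f) * (2 * (q * v) * (2 * (q * v) * (2 * e)))
    = 24 * (v ^ 3 * e * q ^ 2 * f) by rewrite !expnS !expn0 !muln1; lia.
  by rewrite leq_mul2l /= leq_mul2l -{1}[f]expn1 leq_pexp2l ?orbT.
have := leq_mul (leqnn (overhead prelude)) r1.
have := leq_mul (leqnn (overhead main_loop)) r2.
move: (overhead _) (overhead _) (rounds _ _) (rounds _ _) => x y z w; nia.
Qed.

Lemma solver_correct C (A : arena C) (D : dfa C) (epsD : ~ language D [::]) s :
  encodes_input A D s ->
  exists (s' : store) (sigma : strategy (game_arena (Game A epsD))),
    [/\ exec_within solver s
          ((8 * overhead prelude + 24 * overhead main_loop) *
           (maxn 1 #|A| ^ 3 * maxn 1 #|edges A| * #|state D| ^ 2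
            * maxn 1 #|accepting D| ^ 2)) s',
        encodes_strategy sigma s' & optimal sigma].
Proof.
move=> enc; have [sigma [es opt]] := main_loop_strategy enc epsD.
by exists (run main_loop (run prelude s)), sigma; split=> //; exact: solver_time.
Qed.

Lemma sum_code (T : finType) (F : T -> nat) x :
  \sum_(y | code y == code x) F y = F x.
Proof. by rewrite (big_pred1 x) // => y; rewrite (inj_eq (@code_inj T)). Qed.

(** This lets the algorithm prove mere existence of a strategy. Each sum has a single term where
    data is stored and is empty elsewhere. *)
Lemma encodes_input_exists C (A : arena C) (D : dfa C) : exists s,
  encodes_input A D s.
Proof.
exists (fun a i => match a with
  | 0 => nth 0 [:: #|A|; #|edges A|; #|state D|; #|C|; code (initial D)] i
  | 1 => \sum_(v : A | code v == i) (v \in owned0 A)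
  | 2 => \sum_(v : A | code v == i) code (color v)
  | 3 => \sum_(j < #|edges A| | j == i :> nat) code (enum_val j).1
  | 4 => \sum_(j < #|edges A| | j == i :> nat) code (enum_val j).2
  | 5 => \sum_(j < #|edges A| | j == i :> nat) weight (enum_val j)
  | 6 => \sum_(y : state D * C | code y.1 * #|C| + code y.2 == i) code (step
    y.1 y.2)
  | 7 => \sum_(q : state D | code q == i) (q \in accepting D)
  | _ => 0
  end); split=> //.
- by move=> v; rewrite !sum_code.
- by move=> i; rewrite !(big_pred1 i).
- move=> q; split; last by rewrite sum_code.
  move=> x; rewrite (big_pred1 (q, x)) // => -[q' x'] /=; rewrite xpair_eqE.
  have cx := code_lt x; have cx' := code_lt x'.
  apply/eqP/andP => [E|[/eqP-> /eqP->]] //.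
  have C0 : 0 < #|C| by exact: leq_ltn_trans cx.
  split; apply/eqP; apply: code_inj.
    have := congr1 (divn^~ #|C|) E; by rewrite !divnMDl // !divn_small // !addn0.
  have := congr1 (modn^~ #|C|) E; by rewrite !modnMDl !modn_small.
- by do 8!case=> //.
Qed.

Theorem theorem1 :
  (forall (C : finType) (G : game C), 0 < #|C| -> regular G ->
     exists sigma : strategy (game_arena G), finite_state sigma /\ optimal sigma)
  /\
  (exists (p : prog) (k : nat),
     forall (C : finType) (A : arena C) (D : dfa C)
            (epsD : ~ language D [::]) (s : store),
       0 < #|C| -> encodes_input A D s ->
       exists (s' : store) (sigma : strategy (game_arena (Game A epsD))),
         [/\ exec_within p s
               (k * (maxn 1 #|A| ^ 3 * maxn 1 #|edges A| * #|state D| ^ 2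
                     * maxn 1 #|accepting D| ^ 2)) s',
             encodes_strategy sigma s'
           & optimal sigma]).
Proof.
split; last first.
  exists solver, (8 * overhead prelude + 24 * overhead main_loop).
  by move=> C A D epsD s _; exact: solver_correct.
move=> C [A K eps] _ [D /= KD]; subst K.
have [s enc] := encodes_input_exists A D.
have [s' [sigma [_ [M [nxt [imp _ _ _ _]]] opt]]] := solver_correct eps enc.
by exists sigma; split=> //; exists M, nxt.
Qed.
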